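(* Let $M$ be a proper $G$-manifold and let $X$ and $Y$ be two isomorphic ($G$-isomorphic) $G$-equivariant vector fields on $M$. If a point $m\in M$ is a $G$-stable relative equilibrium of the vector field $X$, then it is a $G$-stable relative equilibrium of the vector field $Y$.
   Context: All manifolds are smooth and Hausdorff. $G$ is a Lie group with Lie algebra $\mathfrak g$. A proper $G$-manifold is a manifold with a smooth proper action of $G$. Write $g_M(m)=g\cdot m$. A vector field $X$ on $M$ is equivariant if $X\circ g_M=\mathrm dg_M\circ X$ for all $g\in G$. A point $m$ is a ($G$-)relative equilibrium of an equivariant vector field $X$ if $X(m)\in T_m(G\cdot m)$. $C^\infty(M,\mathfrak g)^G$ is the space of smooth maps $\psi\colon M\to\mathfrak g$ with $\psi(g\cdot m)=\mathrm{Ad}(g)\psi(m)$; such a $\psi$ induces the vector field $\psi_M(m)=\frac{\mathrm d}{\mathrm dt}\big|_0\exp(t\psi(m))\cdot m$. Two equivariant vector fields $X,Y$ are ($G$-)isomorphic if $Y=X+\psi_M$ for some $\psi\in C^\infty(M,\mathfrak g)^G$. A $G$-relative equilibrium $m$ of $X$ is $G$-stable if for every $G$-invariant neighborhood $U$ of $m$ there is a neighborhood $O\subseteq U$ of $m$ such that all maximal integral curves of $X$ starting at points of $O$ stay in $U$ for all times for which they are defined. *)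

(* Defs.v *)
From HB Require Import structures.
From mathcomp Require Import all_boot all_order all_algebra.
From mathcomp Require Import all_classical all_reals all_analysis.

Set Implicit Arguments.
Unset Strict Implicit.
Unset Printing Implicit Defensive.

Import Order.TTheory GRing.Theory Num.Theory.
Import numFieldNormedType.Exports.

Local Open Scope classical_set_scope.
Local Open Scope ring_scope.

Section SmoothCalculus.
Context {R : realType} {E F : normedModType R}.

(* Used with [U] open and [E], [F] finite-dimensional: all iterated directional
   derivatives of [f] of order at most [k] exist and are continuous on [U]. *)
Fixpoint is_Ck (k : nat) (U : set E) (f : E -> F) : Prop :=
  (forall x, U x -> {for x, continuous f}) /\
  (if k is k'.+1 then
     forall v : E, (forall x, U x -> derivable f x v) /\ is_Ck k' U ('D_v f)
   else True).

Definition is_Cinfty (U : set E) (f : E -> F) : Prop := forall k, is_Ck k U f.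

End SmoothCalculus.

Section Charts.
Context {R : realType}.

(* A homeomorphism from an open subset of [M] onto an open subset of [E]; both
   maps are total, with irrelevant values off [chart_dom] and [chart_cod]. *)
Record chart (M : topologicalType) (E : normedModType R) := Chart {
  chart_dom : set M;
  chart_cod : set E;
  chart_map :> M -> E;
  chart_inv : E -> M;
  chart_dom_open : open chart_dom;
  chart_cod_open : open chart_cod;
  chart_map_cod : forall p, chart_dom p -> chart_cod (chart_map p);
  chart_inv_dom : forall x, chart_cod x -> chart_dom (chart_inv x);
  chart_mapK : forall p, chart_dom p -> chart_inv (chart_map p) = p;
  chart_invK : forall x, chart_cod x -> chart_map (chart_inv x) = x;
  chart_map_continuous : forall p, chart_dom p -> {for p, continuous chart_map};
  chart_inv_continuous : forall x, chart_cod x -> {for x, continuous chart_inv}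
}.

Program Definition id_chart (E : normedModType R) : chart E E :=
  @Chart E E setT setT id id _ _ _ _ _ _ _ _.
Next Obligation. by move=> E; exact: openT. Qed.
Next Obligation. by move=> E; exact: openT. Qed.
Next Obligation. by []. Qed.
Next Obligation. by []. Qed.
Next Obligation. by []. Qed.
Next Obligation. by []. Qed.
Next Obligation. by move=> E p _; exact: cvg_id. Qed.
Next Obligation. by move=> E p _; exact: cvg_id. Qed.

Fact open_setX (S T : topologicalType) (A : set S) (B : set T) :
  open A -> open B -> open (A `*` B).
Proof.
move=> oA oB; rewrite openE => -[x y] [/= Ax By].
by exists (A, B) => //; split; exact: open_nbhs_nbhs.
Qed.

Section Product.
Context {M N : topologicalType} {E F : normedModType R}.
Variables (a : chart M E) (b : chart N F).

Let map_prod (p : M * N) : E * F := (a p.1, b p.2).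
Let inv_prod (x : E * F) : M * N := (chart_inv a x.1, chart_inv b x.2).

Fact prod_chart_map_continuous p : (chart_dom a `*` chart_dom b) p ->
  {for p, continuous map_prod}.
Proof.
move=> [ap bp]; apply: (@cvg_pair _ _ _ _ (nbhs (a p.1)) (nbhs (b p.2))).
  apply: (@cvg_comp _ _ _ fst a _ (nbhs p.1)); first exact: cvg_fst.
  exact: chart_map_continuous.
apply: (@cvg_comp _ _ _ snd b _ (nbhs p.2)); first exact: cvg_snd.
exact: chart_map_continuous.
Qed.

Fact prod_chart_inv_continuous x : (chart_cod a `*` chart_cod b) x ->
  {for x, continuous inv_prod}.
Proof.
move=> [ax bx].
apply: (@cvg_pair _ _ _ _ (nbhs (chart_inv a x.1)) (nbhs (chart_inv b x.2))).
  apply: (@cvg_comp _ _ _ fst (chart_inv a) _ (nbhs x.1)); first exact: cvg_fst.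
  exact: chart_inv_continuous.
apply: (@cvg_comp _ _ _ snd (chart_inv b) _ (nbhs x.2)); first exact: cvg_snd.
exact: chart_inv_continuous.
Qed.

Program Definition prod_chart : chart (M * N)%type (E * F)%type :=
  @Chart (M * N)%type (E * F)%type
    (chart_dom a `*` chart_dom b) (chart_cod a `*` chart_cod b)
    map_prod inv_prod _ _ _ _ _ _
    prod_chart_map_continuous prod_chart_inv_continuous.
Next Obligation. by apply: open_setX; exact: chart_dom_open. Qed.
Next Obligation. by apply: open_setX; exact: chart_cod_open. Qed.
Next Obligation. by move=> p [? ?]; split; exact: chart_map_cod. Qed.
Next Obligation. by move=> x [? ?]; split; exact: chart_inv_dom. Qed.
Next Obligation.
by move=> [p q] [/= ? ?]; rewrite /inv_prod /map_prod /= !chart_mapK.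
Qed.
Next Obligation.
by move=> [x y] [/= ? ?]; rewrite /inv_prod /map_prod /= !chart_invK.
Qed.

End Product.

Definition prod_atlas {M N : topologicalType} {E F : normedModType R}
    (A : set (chart M E)) (B : set (chart N F)) :
    set (chart (M * N)%type (E * F)%type) :=
  [set c | exists a b, [/\ A a, B b & c = prod_chart a b]].

(* Smoothness on the open set [U] with respect to the atlases [A] and [B]. *)
Definition smooth_map {M N : topologicalType} {E F : normedModType R}
    (A : set (chart M E)) (B : set (chart N F)) (U : set M) (f : M -> N) :=
  (forall p, U p -> {for p, continuous f}) /\
  (forall a b, A a -> B b ->
    is_Cinfty [set x | [/\ chart_cod a x, U (chart_inv a x)
                         & chart_dom b (f (chart_inv a x))]]
              (b \o f \o chart_inv a)).

End Charts.

(* Second countability is not required.  [chart_at] is a choice of a chart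
   around each point, used below to represent tangent vectors. *)
HB.mixin Record isManifold (R : realType) (n : nat) M of Topological M := {
  manifold_hausdorff : hausdorff_space M;
  atlas : set (chart M 'rV[R]_n);
  chart_at : M -> chart M 'rV[R]_n;
  chart_at_atlas : forall p, atlas (chart_at p);
  chart_at_dom : forall p, chart_dom (chart_at p) p;
  atlas_compatible : forall a b, atlas a -> atlas b ->
    is_Cinfty [set x | chart_cod a x /\ chart_dom b (chart_inv a x)]
              (b \o chart_inv a)
}.

#[short(type="manifoldType")]
HB.structure Definition Manifold (R : realType) (n : nat) :=
  {M of Topological M & isManifold R n M}.

Arguments atlas {R n} M : rename.

HB.mixin Record isLieGroup (R : realType) (k : nat) G
    of Manifold R k G & Group G := {
  mulg_smooth :
    smooth_map (prod_atlas (atlas G) (atlas G)) (atlas G) setT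
      (fun gh : G * G => (gh.1 * gh.2)%g);
  invg_smooth : smooth_map (atlas G) (atlas G) setT (fun g : G => g^-1%g)
}.

#[short(type="lieGroupType")]
HB.structure Definition LieGroup (R : realType) (k : nat) :=
  {G of Manifold R k G & Group G & isLieGroup R k G}.

(* A tangent vector at [p : M] is a vector of ['rV[R]_n]: its coordinates in
   the chart [chart_at p].  In particular the Lie algebra of [G] is the tangent
   space ['rV[R]_k] at [1%g]. *)
Section TangentVectors.
Context {R : realType}.

Definition tangent_map {m n : nat} {M : manifoldType R m} {N : manifoldType R n}
    (f : M -> N) (p : M) : 'rV[R]_m -> 'rV[R]_n :=
  'd (chart_at (f p) \o f \o chart_inv (chart_at p)) (chart_at p p).

Definition chart_coord {n : nat} {M : manifoldType R n}
    (c : chart M 'rV[R]_n) (p : M) : 'rV[R]_n -> 'rV[R]_n :=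
  'd (c \o chart_inv (chart_at p)) (chart_at p p).

Definition velocity {n : nat} {M : manifoldType R n} (gamma : R -> M) (t : R) :
    'rV[R]_n :=
  derive1 (fun s => chart_at (gamma t) (gamma s)) t.

Definition smooth_curve {n : nat} {M : manifoldType R n} (J : set R)
    (gamma : R -> M) : Prop :=
  smooth_map [set id_chart R^o] (atlas M) (J : set R^o) (gamma : R^o -> M).

(* For an embedded submanifold [S] (such as an orbit of a proper action), the
   velocities at [p] of the smooth curves in [S] form the tangent space at [p]. *)
Definition tangent_to {n : nat} {M : manifoldType R n} (S : set M) (p : M) :
    set 'rV[R]_n :=
  [set v | exists (J : set R) (gamma : R -> M),
    [/\ open J, J 0, smooth_curve J gamma & gamma @` J `<=` S]
    /\ gamma 0 = p /\ velocity gamma 0 = v].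

Definition smooth_vector_field {n : nat} {M : manifoldType R n}
    (X : M -> 'rV[R]_n) : Prop :=
  forall c, atlas M c ->
    is_Cinfty (chart_cod c)
      (fun x => chart_coord c (chart_inv c x) (X (chart_inv c x))).

Definition integral_curve {n : nat} {M : manifoldType R n} (X : M -> 'rV[R]_n)
    (J : set R) (gamma : R -> M) : Prop :=
  [/\ open J, is_interval J, J 0 &
    forall t, J t -> {for t, continuous gamma} /\
      is_derive t (1 : R) (fun s => chart_at (gamma t) (gamma s))
        (X (gamma t))].

Definition maximal_integral_curve {n : nat} {M : manifoldType R n}
    (X : M -> 'rV[R]_n) (J : set R) (gamma : R -> M) : Prop :=
  integral_curve X J gamma /\
  forall (K : set R) (delta : R -> M), integral_curve X K delta ->
    J `<=` K -> {in J, delta =1 gamma} -> K `<=` J.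

End TangentVectors.

Section LieGroupTheory.
Context {R : realType} {k : nat} {G : lieGroupType R k}.

Definition Ad (g : G) : 'rV[R]_k -> 'rV[R]_k :=
  tangent_map (fun h : G => (g * h * g^-1)%g) (1%g : G).

Definition one_parameter_subgroup (xi : 'rV[R]_k) (c : R -> G) : Prop :=
  [/\ smooth_curve setT c, forall s t, c (s + t) = (c s * c t)%g
    & velocity c 0 = xi].

(* There is exactly one one-parameter subgroup with initial velocity [xi], so
   the default value of [xget] is never used. *)
Definition Lie_exp (xi : 'rV[R]_k) : G :=
  xget (fun=> 1%g) (one_parameter_subgroup xi) 1.

End LieGroupTheory.

Section Actions.
Context {R : realType} {k n : nat} {G : lieGroupType R k} {M : manifoldType R n}.

Record proper_action (act : G -> M -> M) : Prop := ProperAction {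
  act1 : forall p, act 1%g p = p;
  actM : forall g h p, act (g * h)%g p = act g (act h p);
  act_smooth : smooth_map (prod_atlas (atlas G) (atlas M)) (atlas M) setT
    (fun gp : G * M => act gp.1 gp.2);
  act_proper : forall K : set (M * M), compact K ->
    compact ((fun gp : G * M => (act gp.1 gp.2, gp.2)) @^-1` K)
}.

Variable act : G -> M -> M.

Definition equivariant_vector_field (X : M -> 'rV[R]_n) : Prop :=
  smooth_vector_field X /\
  forall g p, X (act g p) = tangent_map (act g) p (X p).

Definition act_orbit (p : M) : set M := range (fun g => act g p).

Definition relative_equilibrium (X : M -> 'rV[R]_n) (p : M) : Prop :=
  tangent_to (act_orbit p) p (X p).

Definition smooth_equivariant_map (psi : M -> 'rV[R]_k) : Prop :=
  smooth_map (atlas M) [set id_chart 'rV[R]_k] setT psi /\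
  forall g p, psi (act g p) = Ad g (psi p).

Definition induced_vector_field (psi : M -> 'rV[R]_k) (p : M) : 'rV[R]_n :=
  velocity (fun t => act (Lie_exp (t *: psi p)) p) 0.

Definition isomorphic_vector_fields (X Y : M -> 'rV[R]_n) : Prop :=
  exists2 psi, smooth_equivariant_map psi &
    forall p, Y p = X p + induced_vector_field psi p.

Definition invariant_set (U : set M) : Prop := forall g p, U p -> U (act g p).

Definition stable_relative_equilibrium (X : M -> 'rV[R]_n) (p : M) : Prop :=
  relative_equilibrium X p /\
  forall U, nbhs p U -> invariant_set U ->
    exists2 O, nbhs p O /\ O `<=` U &
      forall (J : set R) (gamma : R -> M), maximal_integral_curve X J gamma ->
        O (gamma 0) -> forall t, J t -> U (gamma t).

End Actions.

(* Main.v *)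
(** Let [gamma] be an integral curve of [Y = X + psi_M].  Along [gamma], solve the
    left-invariant equation [g' = dL_g (- psi (gamma t))], [g 0 = 1], in the Lie
    group.  Since [X] is equivariant, [t |-> g t . gamma t] is an integral curve of
    [X] with the same initial point, and it visits the same invariant sets as
    [gamma]; hence a neighborhood that witnesses stability for [X] also does so
    for [Y].  The solution [g] is obtained locally by Picard iteration in a chart;
    two solutions differ by a constant left factor, which glues them along the
    whole interval.  For constant right-hand side this also yields the
    one-parameter subgroups behind [Lie_exp]. *)
Require Import Defs.
From HB Require Import structures.
From mathcomp Require Import all_boot all_order all_algebra.
From mathcomp Require Import all_classical all_reals all_analysis.
From mathcomp Require Import ring lra.

Set Implicit Arguments.
Unset Strict Implicit.
Unset Printing Implicit Defensive.

Import Order.TTheory GRing.Theory Num.Theory.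
Import numFieldNormedType.Exports.

Local Open Scope classical_set_scope.
Local Open Scope ring_scope.

(** * Differential calculus in finite dimension *)

(** Three obstacles shape the work. An integral curve [gamma] is only differentiable in charts, so
    [psi \o gamma] is only known to be continuous: the equation for [g] has merely continuous time
    dependence, and the Picard iteration is set up for that case. Stability speaks of maximal
    integral curves, while the twisted curve lives on the domain of [gamma] and may be extendable as
    an integral curve of [X]; it is prolonged by Zorn's lemma before stability is applied. Finally,
    [is_Ck] only speaks of iterated directional derivatives, so Frechet differentiability and the
    chain rule have to be derived from it through finitely many coordinates.

    The minus sign in the equation makes the velocity contributed by [g] cancel [psi_M]. That [m] is
    again a relative equilibrium is a separate matter: [tangent_to] is a set of velocities of
    curves, so adding [psi_M(m)] requires a new curve in the orbit, and it is here that
    one-parameter subgroups must be smooth. *)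

Section MeanValue.
Context {R : realType}.

Lemma is_derive_coord n (f : R -> 'rV[R]_n) (t : R) (d : 'rV[R]_n) i :
  is_derive t (1 : R) f d -> is_derive t (1 : R) (fun s => f s 0 i : R) (d 0 i).
Proof.
move=> fd; have /derivable_mxP fi : derivable f t 1 by exact: ex_derive.
apply: DeriveDef; first exact: fi.
have fdv : 'D_1 f t = d by exact: derive_val.
by rewrite -fdv derive_mx ?mxE//; exact: ex_derive.
Qed.

Lemma is_derive_rV n (f : R -> 'rV[R]_n) (t : R) (d : 'rV[R]_n) :
  (forall i, is_derive t (1 : R) (fun s => f s 0 i : R) (d 0 i)) ->
  is_derive t (1 : R) f d.
Proof.
move=> fd; have df : derivable f t 1.
  by apply/derivable_mxP => i j; rewrite ord1; apply: ex_derive.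
apply: DeriveDef => //; rewrite derive_mx//.
by apply/rowP => i; rewrite mxE; exact: derive_val.
Qed.

Lemma rV_norm_le n (x : 'rV[R]_n) (C : R) : 0 <= C ->
  (forall i, `|x 0 i| <= C) -> `|x| <= C.
Proof.
move=> C0 xC; rewrite /Num.Def.normr/= mx_normrE bigmax_le// => -[i j] _ /=.
by rewrite ord1.
Qed.

Lemma coord_le_norm n (x : 'rV[R]_n) i : `|x 0 i| <= `|x|.
Proof.
rewrite {2}/Num.Def.normr/= mx_normrE.
exact: (le_bigmax _ (fun i => `|x i.1 i.2|) (ord0, i)).
Qed.

(** The scalar mean value theorem in each coordinate suffices because rows carry the max norm. The
    hypotheses range over a ball around [a], so that one statement serves [b] on either side of
    [a]. *)
Lemma mean_value_le n (f df : R -> 'rV[R]_n) (a b C : R) :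
  (forall t, `|t - a| <= `|b - a| -> is_derive t (1 : R) f (df t)) ->
  (forall t, `|t - a| <= `|b - a| -> `|df t| <= C) ->
  `|f b - f a| <= C * `|b - a|.
Proof.
move=> fd dC; have C0 : 0 <= C.
  by apply: le_trans (dC a _); rewrite // subrr normr0.
apply: rV_norm_le => [|i]; first by rewrite mulr_ge0.
rewrite !mxE.
have dfi t : `|t - a| <= `|b - a| ->
    is_derive t (1 : R) (fun s => f s 0 i : R) (df t 0 i).
  by move=> /fd; exact: is_derive_coord.
have dCi t : `|t - a| <= `|b - a| -> `|df t 0 i| <= C.
  by move=> /dC; apply: le_trans; exact: coord_le_norm.
have cont c d : (forall t, t \in `[c, d] -> `|t - a| <= `|b - a|) ->
    {within `[c, d], continuous (fun s => f s 0 i : R)}.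
  move=> H; apply: derivable_within_continuous => t /H/dfi td.
  exact: ex_derive.
case: (leP a b) => ab.
  have H t : t \in `[a, b] -> `|t - a| <= `|b - a|.
    by rewrite in_itv/= => /andP[? ?]; rewrite !ger0_norm; lra.
  have [|t /H tab ->] :=
    @MVT_segment R (fun s => f s 0 i) (fun s => df s 0 i) a b ab _ (cont _ _ H).
    by move=> t /subset_itv_oo_cc; rewrite inE => /H/dfi.
  by rewrite normrM ler_wpM2r// dCi.
have H t : t \in `[b, a] -> `|t - a| <= `|b - a|.
  by rewrite in_itv/= => /andP[? ?]; rewrite !ler0_norm; lra.
rewrite distrC [X in C * X]distrC.
have [|t /H tab ->] :=
  @MVT_segment R (fun s => f s 0 i) (fun s => df s 0 i) b a (ltW ab) _ (cont _ _ H).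
  by move=> t /subset_itv_oo_cc; rewrite inE => /H/dfi.
by rewrite normrM ler_wpM2r// dCi.
Qed.

Lemma is_derive_scalel (E : normedModType R) (v : E) (t : R) :
  is_derive t (1 : R) ( *:%R^~ v) v.
Proof.
have sd : is_diff (t : R^o) ( *:%R^~ v) ( *:%R^~ v) by exact: is_diff_scalel.
have dd := @ex_diff _ _ _ _ _ _ _ sd.
apply: DeriveDef; first exact/derivable1_diffP.
by rewrite deriveE// diff_val scale1r.
Qed.

Lemma is_derive_affine (E : normedModType R) (p v : E) (t : R) :
  is_derive t (1 : R) (fun s : R => p + s *: v) v.
Proof.
rewrite -[X in is_derive _ _ _ X]add0r.
apply: (@is_deriveD R R^o E (cst p) (fun s : R => s *: v) t 1 0 v).
exact: is_derive_scalel.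
Qed.

Lemma is_derive_differentiable (E : normedModType R) (f : R -> E) (t : R) (d : E) :
  is_derive t (1 : R) f d -> differentiable f t.
Proof. by move=> [df _]; exact/derivable1_diffP. Qed.

Lemma is_derive_continuous (E : normedModType R) (f : R -> E) (t : R) (d : E) :
  is_derive t (1 : R) f d -> {for t, continuous f}.
Proof. by move=> /is_derive_differentiable; exact: differentiable_continuous. Qed.

End MeanValue.

(** * Coordinates and Frechet differentiability *)

Section Coordinates.
Context {R : realType}.

(* Both ['rV_n] and products carry the max norm, whence the constant 1 in
   [coor_le]. *)
Record coordinates (E : normedModType R) (I : finType) := Coordinates {
  cvec : I -> E;
  coor : I -> E -> R;
  coor_linear : forall i (a : R) (x y : E), coor i (a *: x + y) = a * coor i x + coor i y;
  coor_le : forall i x, `|coor i x| <= `|x|;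
  coor_sum : forall x, x = \sum_i coor i x *: cvec i }.

Program Definition rV_coordinates n : coordinates 'rV[R]_n 'I_n :=
  @Coordinates _ _ (fun i => delta_mx 0 i) (fun i x => x 0 i) _ _ _.
Next Obligation. by move=> n i a x y /=; rewrite !mxE. Qed.
Next Obligation. by move=> n i x /=; exact: coord_le_norm. Qed.
Next Obligation. by move=> n x; exact: row_sum_delta. Qed.

Program Definition prod_coordinates (E F : normedModType R) (I J : finType)
    (c : coordinates E I) (d : coordinates F J) : coordinates (E * F)%type (I + J)%type :=
  @Coordinates _ _
    (fun k => match k with inl i => (cvec c i, 0) | inr j => (0, cvec d j) end)
    (fun k x => match k with inl i => coor c i x.1 | inr j => coor d j x.2 end) _ _ _.
Next Obligation. by move=> E F I J c d [i|j] a x y /=; rewrite coor_linear. Qed.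
Next Obligation.
move=> E F I J c d [i|j] x /=; rewrite prod_normE le_max.
  by rewrite coor_le.
by rewrite coor_le orbT.
Qed.
Next Obligation.
move=> E F I J c d [x y]; rewrite big_sumType/=.
rewrite [in LHS](coor_sum c x) [in LHS](coor_sum d y).
have -> : \sum_(i in I) coor c i x *: (cvec c i, 0 : F) =
    (\sum_(i in I) coor c i x *: cvec c i, 0).
  elim/big_ind2 : _ => // [a1 b1 a2 b2 -> ->|i _].
    by congr pair; rewrite /= addr0.
  by congr pair; rewrite /= scaler0.
have -> : \sum_(i in J) coor d i y *: (0 : E, cvec d i) =
    (0, \sum_(i in J) coor d i y *: cvec d i).
  elim/big_ind2 : _ => // [a1 b1 a2 b2 -> ->|i _].
    by congr pair; rewrite /= addr0.
  by congr pair; rewrite /= scaler0.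
by congr pair; rewrite /= ?addr0 ?add0r.
Qed.

End Coordinates.

Section Frechet.
Context {R : realType} {E : normedModType R} {I : finType} {n : nat}.
Variable c : coordinates E I.
Implicit Type f : E -> 'rV[R]_n.

Lemma is_derive_line f (x v : E) (s : R) : derivable f (s *: v + x) v ->
  is_derive s (1 : R) (fun t => f (t *: v + x)) ('D_v f (s *: v + x)).
Proof.
move=> df.
have eqg : (fun h : R => h^-1 *: (f ((h *: 1 + s) *: v + x) - f (s *: v + x)))
   = (fun h : R => h^-1 *: ((f \o shift (s *: v + x)) (h *: v) - f (s *: v + x))).
  apply/funext => h /=; congr (_ *: (f _ - _)).
  by rewrite scalerDl addrA [h *: 1]mulr1.
apply: DeriveDef; first by rewrite /derivable/= eqg.
by rewrite /derive/= eqg.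
Qed.

(* The increment of [f] along [h] is telescoped over the coordinates of [h]; each
   summand is controlled by the mean value inequality. *)
Lemma differentiable_C1 f x :
  (\forall y \near x, forall i, derivable f y (cvec c i)) ->
  (forall i, {for x, continuous ('D_(cvec c i) f)}) ->
  differentiable f x /\
  forall h, 'd f x h = \sum_i coor c i h *: 'D_(cvec c i) f x.
Proof.
move=> dfx cfx.
pose L h := \sum_i coor c i h *: 'D_(cvec c i) f x.
have Llin : linear L.
  move=> a u v; rewrite /L scaler_sumr -big_split/=; apply: eq_bigr => i _.
  by rewrite coor_linear scalerDl scalerA.
pose LL : {linear E -> 'rV[R]_n} := HB.pack L (GRing.isLinear.Build _ _ _ _ L Llin).
have Lc : continuous LL.
  apply: (linear_bounded_continuous LL).1; apply/(linear_boundedP LL).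
  exists (\sum_i `|'D_(cvec c i) f x|); split=> [|r Br h]; first exact: num_real.
  rewrite /LL/= /L (le_trans (ler_norm_sum _ _ _))//.
  apply: (@le_trans _ _ (\sum_i `|'D_(cvec c i) f x| * `|h|)).
    by apply: ler_sum => i _; rewrite normrZ mulrC ler_wpM2l// coor_le.
  by rewrite -mulr_suml ler_wpM2r// ltW.
suff key : f \o shift x = cst (f x) + LL +o_ 0 id.
  have dE := diff_unique Lc key.
  by split; [apply/diff_locallyP; rewrite dE|rewrite dE].
apply/eqaddoP => e e0.
pose S (s : seq I) h := \sum_(i <- s) coor c i h *: cvec c i.
suff [d d0 H] : exists2 d : R, 0 < d & forall h, `|h| < d ->
    `|f (S (index_enum I) h + x) - f x - L h| <= e * `|h|.
  near=> h; rewrite /= !fctE opprD addrA /shift/= [in f (h + x)](coor_sum c h).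
  by apply: H; near: h; exact: nbhs0_lt.
rewrite /L.
(* [e] stays general: the coordinate at the head of the list spends [e / 2], the remaining ones the
   other half. *)
elim: (index_enum I) e e0 => [|i s IH] e e0.
  by exists 1 => // h _; rewrite /S !big_nil add0r subrr subr0 normr0 mulr_ge0// ltW.
have e2 : 0 < e / 2 by rewrite divr_gt0.
have [d1 d10 H1] := IH _ e2.
have : \forall y \near x, derivable f y (cvec c i) /\
    `|'D_(cvec c i) f y - 'D_(cvec c i) f x| <= e / 2.
  near=> y; split; first by apply: (near dfx).
  near: y; move/cvgrPdist_le : (cfx i) => /(_ _ e2); apply: filterS => y.
  by rewrite distrC.
case/nbhs_normP => d2 /= d20 H2.
(* The broken path from [x] in the coordinate directions stays within [B * |h|] of [x]; hence the
   bound [d2 / B] below. The summand 1 makes [B] positive. *)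
pose B := `|cvec c i| + \sum_(j <- s) `|cvec c j| + 1.
have B0 : 0 < B by rewrite ltr_wpDl// addr_ge0// sumr_ge0.
exists (Num.min d1 (d2 / B)); first by rewrite lt_min d10 divr_gt0.
move=> h; rewrite lt_min => /andP[hd1 hd2].
have SB : `|S s h| <= (\sum_(j <- s) `|cvec c j|) * `|h|.
  rewrite /S (le_trans (ler_norm_sum _ _ _))// mulr_suml; apply: ler_sum => j _.
  by rewrite normrZ mulrC ler_wpM2l// coor_le.
have clos (t : R) : `|t| <= `|coor c i h| ->
    derivable f (t *: cvec c i + (S s h + x)) (cvec c i) /\
    `|'D_(cvec c i) f (t *: cvec c i + (S s h + x)) - 'D_(cvec c i) f x| <= e / 2.
  move=> tc; apply: H2; rewrite /ball_/= addrA opprD addrCA subrr addr0 normrN.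
  rewrite (le_lt_trans (ler_normD _ _))//.
  rewrite ltr_pdivlMr// in hd2; apply: le_lt_trans hd2; rewrite mulrC.
  rewrite /B !mulrDl -[leLHS]addr0 !lerD ?mul1r// normrZ [leRHS]mulrC.
  by rewrite ler_wpM2r// (le_trans tc)// coor_le.
(* With the linear term removed, the derivative is at most [e / 2] along the segment. *)
pose phi (t : R) := f (t *: cvec c i + (S s h + x)) - t *: 'D_(cvec c i) f x.
have := @mean_value_le R n phi
  (fun t => 'D_(cvec c i) f (t *: cvec c i + (S s h + x)) - 'D_(cvec c i) f x)
  0 (coor c i h) (e / 2).
rewrite !subr0 => /(_ _ _) mv.
rewrite /S !big_cons -/(S s h).
have -> : f (coor c i h *: cvec c i + S s h + x) - f x -
   (coor c i h *: 'D_(cvec c i) f x + \sum_(j <- s) coor c j h *: 'D_(cvec c j) f x)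
  = (phi (coor c i h) - phi 0) +
    (f (S s h + x) - f x - \sum_(j <- s) coor c j h *: 'D_(cvec c j) f x).
  by rewrite /phi !scale0r add0r subr0 !addrA subrK opprD !addrA [X in X - _](addrAC (f _)).
rewrite (le_trans (ler_normD _ _))// [in leRHS](splitr e) mulrDl lerD//; last exact: H1.
apply: (@le_trans _ _ (e / 2 * `|coor c i h|)).
  apply: mv => t; rewrite subr0 => /clos[dt dl]; last exact: dl.
  apply: is_deriveB; first exact: is_derive_line.
  exact: is_derive_scalel.
by rewrite ler_wpM2l ?coor_le// ltW.
Unshelve. all: by end_near. Qed.

End Frechet.

(** * Calculus of C^k maps *)

Section CkTheory.
Context {R : realType} {E F : normedModType R}.
Implicit Types (U V : set E) (f g : E -> F).

Lemma is_Ck_sub k U V f : V `<=` U -> is_Ck k U f -> is_Ck k V f.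
Proof.
move=> VU; elim: k f => [|k IH] f [cf df].
  by split => // x /VU; exact: cf.
split=> [x /VU|v]; first exact: cf.
have [dv kv] := df v; split; last exact: IH.
by move=> x /VU; exact: dv.
Qed.

Lemma is_CkS k U f : is_Ck k.+1 U f -> is_Ck k U f.
Proof.
elim: k f => [|k IH] f [cf df]; first by split.
split=> // v; have [dv kv] := df v; split=> //; exact: IH.
Qed.

(** Openness enters because the derivatives at a point depend on the values in a neighborhood of
    it. *)
Lemma is_Ck_congr k U f g : open U -> (forall x, U x -> f x = g x) ->
  is_Ck k U f -> is_Ck k U g.
Proof.
move=> oU; elim: k f g => [|k IH] f g fg [cf df];
  have nfg x : U x -> \forall y \near x, f y = g y.
1,3: by move=> Ux; near=> y; apply: fg; near: y; exact: open_nbhs_nbhs.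
all: have cg x : U x -> {for x, continuous g}.
1,3: by move=> Ux; rewrite /prop_for /continuous_at -fg//;
     apply: cvg_trans (cf x Ux); apply: near_eq_cvg; exact: nfg.
  by split.
split=> // v; have [dv kv] := df v; split=> [x Ux|].
  by apply: near_eq_derivable (dv x Ux); exact: nfg.
apply: IH kv => x Ux; apply: near_eq_derive; exact: nfg.
Unshelve. all: by end_near. Qed.

(** Each clause of [is_Ck] is a condition at single points on one total function, so it can be
    checked point by point. *)
Lemma is_Ck_local k U f :
  (forall x, U x -> exists V, [/\ V x & is_Ck k V f]) -> is_Ck k U f.
Proof.
elim: k f => [|k IH] f H.
  by split=> // x /H[V [Vx [+ _]]]; exact.
split=> [x /H[V [Vx [+ _]]]|v]; first exact.
split=> [x /H[V [Vx [_ /(_ v)[+ _]]]]|]; first exact.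
by apply: IH => x /H[V [Vx [_ /(_ v)[_ ?]]]]; exists V.
Qed.

Lemma is_Ck_cst k U (a : F) : is_Ck k U (fun=> a).
Proof.
elim: k a => [|k IH] a.
  by split=> // x _; exact: cvg_cst.
split=> [x _|v]; first exact: cvg_cst.
split=> [x _|]; first exact: derivable_cst.
have -> : 'D_v (fun=> a) = (fun=> 0).
  by apply/funext => x; exact: derive_cst.
exact: IH.
Qed.

Lemma is_CkD k U f g : open U -> is_Ck k U f -> is_Ck k U g ->
  is_Ck k U (fun x => f x + g x).
Proof.
move=> oU; elim: k f g => [|k IH] f g [cf df] [cg dg].
  by split => // x Ux; apply: cvgD; [exact: cf|exact: cg].
split=> [x Ux|v]; first by apply: cvgD; [exact: cf|exact: cg].
have [dvf kf] := df v; have [dvg kg] := dg v; split=> [x Ux|].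
  by apply: derivableD; [exact: dvf|exact: dvg].
apply: is_Ck_congr (IH _ _ kf kg) => // x Ux.
by rewrite deriveD//; [exact: dvf|exact: dvg].
Qed.

Lemma is_Ck_sum k U (I : Type) (s : seq I) (f : I -> E -> F) : open U ->
  (forall i, is_Ck k U (f i)) -> is_Ck k U (fun x => \sum_(i <- s) f i x).
Proof.
move=> oU fU; elim: s => [|i s IH].
  by apply: is_Ck_congr (is_Ck_cst k U 0) => // x; rewrite big_nil.
apply: is_Ck_congr (is_CkD oU (fU i) IH) => // x Ux.
by rewrite big_cons.
Qed.

End CkTheory.

Lemma continuous_scale (R : realType) (T : topologicalType)
    (V : normedModType R) (a : T -> R^o) (f : T -> V) (x : T) :
  {for x, continuous a} -> {for x, continuous f} ->
  {for x, continuous (fun y => a y *: f y)}.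
Proof. by move=> ca cf; exact: (@cvgZ R V T _ _ a f (a x) (f x) ca cf). Qed.

Lemma continuous_sum (R : realType) (T : topologicalType) (V : normedModType R)
    (I : Type) (s : seq I) (f : I -> T -> V) (x : T) :
  (forall i, {for x, continuous (f i)}) ->
  {for x, continuous (fun y => \sum_(i <- s) f i y)}.
Proof.
move=> fc; elim: s => [|i s IH].
  have -> : (fun y => \sum_(i <- [::]) f i y) = fun=> 0.
    by apply/funext => y; rewrite big_nil.
  exact: cvg_cst.
have -> : (fun y => \sum_(j <- i :: s) f j y) = (fun y => f i y + \sum_(j <- s) f j y).
  by apply/funext => y; rewrite big_cons.
exact: cvgD (fc i) IH.
Qed.

Section Products.
Context {R : realType} {E : normedModType R} {n : nat}.

Lemma is_derive_scale (a : E -> R^o) (f : E -> 'rV[R]_n) x v :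
  derivable a x v -> derivable f x v ->
  is_derive x v (fun y => a y *: f y) ('D_v a x *: f x + a x *: 'D_v f x).
Proof.
move=> da df; have := df => /derivable_mxP df'.
have dm : derivable (fun y => a y *: f y) x v.
  apply/derivable_mxP => i j.
  have -> : (fun y => (a y *: f y) i j) = (a * (fun y => f y i j)).
    by apply/funext => y; rewrite mxE.
  exact: (derivableM da (df' i j)).
apply: DeriveDef => //; rewrite derive_mx//; apply/matrixP => i j.
rewrite mxE.
have -> : (fun y => (a y *: f y) i j) = (a * (fun y => f y i j)).
  by apply/funext => y; rewrite mxE.
rewrite (deriveM da (df' i j)) addrC (derive_mx df) !mxE.
set da' := 'D_v a x.
by rewrite -[_ *: da']/(_ * da') [f x i j * _]mulrC.
Qed.

Lemma is_Ck_scale k (U : set E) (a : E -> R^o) (f : E -> 'rV[R]_n) : open U ->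
  is_Ck k U a -> is_Ck k U f -> is_Ck k U (fun x => a x *: f x).
Proof.
move=> oU; elim: k a f => [|k IH] a f ak fk; have [ca da] := ak; have [cf df] := fk.
  by split=> [x Ux|]; [exact: continuous_scale (ca x Ux) (cf x Ux)|].
split=> [x Ux|v]; first exact: continuous_scale (ca x Ux) (cf x Ux).
have [dva ka] := da v; have [dvf kf] := df v.
split=> [x Ux|].
  by apply: ex_derive; apply: is_derive_scale; [exact: dva|exact: dvf].
apply: (@is_Ck_congr _ _ _ _ _ (fun x => 'D_v a x *: f x + a x *: 'D_v f x)) => //.
  move=> x Ux; apply/esym/derive_val.
  by apply: is_derive_scale; [exact: dva|exact: dvf].
by apply: is_CkD => //; apply: IH => //; exact: is_CkS.
Qed.

Lemma is_Ck_coord k (U : set E) (f : E -> 'rV[R]_n) i : open U ->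
  is_Ck k U f -> is_Ck k U (fun x => f x 0 i : R^o).
Proof.
move=> oU; elim: k f => [|k IH] f [cf df].
  split=> // x Ux; apply: (@continuous_comp _ _ _ f (fun y : 'rV[R]_n => y 0 i)).
    exact: cf.
  exact: coord_continuous.
split=> [x Ux|v].
  apply: (@continuous_comp _ _ _ f (fun y : 'rV[R]_n => y 0 i)).
    exact: cf.
  exact: coord_continuous.
have [dv kv] := df v; split=> [x Ux|].
  by have /derivable_mxP := dv x Ux; exact.
apply: is_Ck_congr (IH _ kv) => // x Ux.
by rewrite derive_mx ?mxE//; exact: dv.
Qed.

End Products.

Section Composition.
Context {R : realType} {E : normedModType R} {I : finType}.
Variable c : coordinates E I.

Lemma is_Ck_differentiable n (U : set E) (f : E -> 'rV[R]_n) x : open U ->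
  is_Ck 1 U f -> U x ->
  differentiable f x /\ forall h, 'd f x h = \sum_i coor c i h *: 'D_(cvec c i) f x.
Proof.
move=> oU [cf df] Ux; apply: differentiable_C1.
  near=> y => i; apply: (df (cvec c i)).1; near: y.
  exact: open_nbhs_nbhs.
by move=> i; apply: (df (cvec c i)).2.1.
Unshelve. all: by end_near. Qed.

Lemma coor_diff (T : normedModType R) (g : T -> E) t v i : differentiable g t ->
  derivable (fun s => coor c i (g s) : R^o) t v /\
  'D_v (fun s => coor c i (g s) : R^o) t = coor c i ('D_v g t).
Proof.
move=> dg.
have clin : linear (coor c i : E -> R^o) by move=> a x y; exact: coor_linear.
pose L : {linear E -> R^o} := HB.pack (coor c i : E -> R^o)
  (GRing.isLinear.Build _ _ _ _ (coor c i : E -> R^o) clin).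
have Lc : continuous L.
  apply: (linear_bounded_continuous L).1; apply/(linear_boundedP L).
  exists 1; split=> // r r1 x; rewrite (le_trans (coor_le c i x))//.
  by rewrite ler_peMl// ltW.
have dL : differentiable L (g t) by exact: linear_differentiable.
have dLg : differentiable (L \o g) t by exact: differentiable_comp.
split; first exact: (@diff_derivable _ _ _ (L \o g)).
transitivity ('d (L \o g) t v); first exact: (@deriveE _ _ _ (L \o g) t v).
rewrite (deriveE v dg) (diff_comp dg dL).
exact: (congr1 (@^~ ('d g t v)) (diff_lin (g t) Lc)).
Qed.

Lemma coor_curve_continuous (T : topologicalType) (g : T -> E) t :
  (forall i, {for t, continuous (fun s => coor c i (g s) : R^o)}) ->
  {for t, continuous g}.
Proof.
move=> gc.
have -> : g = fun s => \sum_i coor c i (g s) *: cvec c i.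
  by apply/funext => s; exact: coor_sum.
apply: continuous_sum => i; apply: continuous_scale (gc i) _; exact: cvg_cst.
Qed.

Lemma coor_curve_differentiable (g : R^o -> E) t :
  (forall i, derivable (fun s => coor c i (g s) : R^o) t 1) ->
  differentiable g t.
Proof.
move=> gd.
have -> : g = fun s => \sum_i coor c i (g s) *: cvec c i.
  by apply/funext => s; exact: coor_sum.
elim: (index_enum I) => [|i s IH].
  have -> : (fun s : R^o => \sum_(i <- [::]) coor c i (g s) *: cvec c i) = cst 0.
    by apply/funext => s; rewrite big_nil.
  exact: differentiable_cst.
have -> : (fun u : R^o => \sum_(i <- i :: s) coor c i (g u) *: cvec c i) =
   (fun u => coor c i (g u) *: cvec c i) + (fun u => \sum_(i <- s) coor c i (g u) *: cvec c i).
  by apply/funext => u; rewrite big_cons.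
apply: differentiableD IH.
by apply: differentiableZl; apply/derivable1_diffP; exact: gd.
Qed.

(** Induction on [k] through the chain rule: the derivative of [f \o g] is a sum of products of a
    derivative of a coordinate of [g] with ['D_(cvec c i) f \o g], all of one order less. Asking for
    smoothness of [g] by coordinates lets [E] be a product space. *)
Lemma is_Ck_comp k n (U : set E) (J : set R^o) (f : E -> 'rV[R]_n) (g : R^o -> E) :
  open U -> open J -> (forall t, J t -> U (g t)) ->
  (forall i, is_Ck k J (fun s => coor c i (g s) : R^o)) ->
  is_Ck k U f -> is_Ck k J (f \o g).
Proof.
move=> oU oJ gJ; elim: k f => [|k IH] f gk fk.
  split; last by [].
  move=> t Jt; apply: continuous_comp.
    by apply: coor_curve_continuous => i; apply: (gk i).1.
  by apply: fk.1; exact: gJ.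
have fg_cont t : J t -> {for t, continuous (f \o g)}.
  move=> Jt; apply: continuous_comp.
    by apply: coor_curve_continuous => i; apply: (gk i).1.
  by apply: fk.1; exact: gJ.
have f1 : is_Ck 1 U f by elim: k fk {IH gk} => // k IHk /is_CkS/IHk.
have dg t : J t -> differentiable g t.
  move=> Jt; apply: coor_curve_differentiable => i.
  by have [_ /(_ 1)[+ _]] := gk i; exact.
have df t : J t -> differentiable f (g t).
  by move=> Jt; have [] := is_Ck_differentiable oU f1 (gJ _ Jt).
split=> // v; split=> [t Jt|].
  apply: diff_derivable; apply: differentiable_comp; [exact: dg|exact: df].
apply: (@is_Ck_congr _ _ _ _ _ (fun t =>
  \sum_i 'D_v (fun s => coor c i (g s) : R^o) t *: ('D_(cvec c i) f \o g) t)) => //.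
  move=> t Jt; rewrite deriveE; last first.
    by apply: differentiable_comp; [exact: dg|exact: df].
  rewrite diff_comp; [|exact: dg|exact: df].
  have [_ /= ->] := is_Ck_differentiable oU f1 (gJ _ Jt).
  apply: eq_bigr => i _; congr (_ *: _).
  by have [_ ->] := coor_diff v i (dg _ Jt); rewrite deriveE//; exact: dg.
apply: is_Ck_sum => // i; apply: is_Ck_scale => //.
  by have [_ /(_ v)[]] := gk i.
apply: IH => [j|]; first exact: is_CkS.
by have [_ /(_ (cvec c i))[]] := fk.
Qed.

End Composition.

(** * The Picard-Lindelof theorem *)

Section Clamp.
Context {R : realType}.
Implicit Types c r s t : R.

Definition clamp c r t : R := Num.min (Num.max t (c - r)) (c + r).

Lemma clamp_dist c r t : 0 <= r -> `|clamp c r t - c| <= r.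
Proof.
move=> r0; rewrite /clamp /Order.max /Order.min.
by case: (ltP t (c - r)) => ?; case: ltP => ?; rewrite ler_norml; apply/andP; split; lra.
Qed.

Lemma clamp_id c r t : `|t - c| <= r -> clamp c r t = t.
Proof.
rewrite ler_norml => /andP[? ?]; rewrite /clamp /Order.max /Order.min.
by case: (ltP t (c - r)) => ?; case: ltP => ?; lra.
Qed.

Lemma clamp_lipschitz c r s t : 0 <= r -> `|clamp c r s - clamp c r t| <= `|s - t|.
Proof.
move=> r0; have := ler_norm (s - t); have := ler_norm (t - s).
rewrite (distrC t s) /clamp /Order.max /Order.min.
by case: (ltP s (c - r)) => ?; case: ltP => ?; case: (ltP t (c - r)) => ?;
  case: ltP => ? ? ?; rewrite ler_norml; apply/andP; split; lra.
Qed.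

Lemma clamp_continuous c r t : 0 <= r -> {for t, continuous (clamp c r)}.
Proof.
move=> r0; apply/cvgrPdist_le => e e0; exists e => //= s /ltW.
exact: le_trans (clamp_lipschitz _ _ _ r0).
Qed.

End Clamp.

Section Picard.
Context {R : realType}.

Lemma antiderivative n (f : R -> 'rV[R]_n) (t0 r : R) :
  (forall t, {for t, continuous f}) -> 0 < r ->
  exists g : R -> 'rV[R]_n, g t0 = 0 /\
    forall t, `|t - t0| < r -> is_derive t (1 : R) g (f t).
Proof.
move=> cf r0.
have cfi i t : {for t, continuous (fun s => f s 0 i : R)}.
  apply: (@continuous_comp _ _ _ f (fun y : 'rV[R]_n => y 0 i)); first exact: cf.
  exact: coord_continuous.
(* Integrating from [t0 - r] puts times on both sides of [t0] to the right of the base point; the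
   value at [t0] is subtracted afterwards. *)
pose G i t := Rintegral lebesgue_measure `[t0 - r, t] (fun s => f s 0 i : R).
exists (fun t => \row_i (G i t - G i t0)); split.
  by apply/rowP => i; rewrite !mxE subrr.
move=> t tr; apply: is_derive_rV => i.
have -> : (fun s => (\row_i0 (G i0 s - G i0 t0)) 0 i : R) = (fun s => G i s - G i t0).
  by apply/funext => s; rewrite mxE.
have tlt : t < t + 1 by rewrite ltrDl.
have [|||dG] := @continuous_FTC1_closed R (fun s => f s 0 i : R) (t0 - r) t (t + 1) tlt.
- apply: continuous_compact_integrable; first exact: segment_compact.
  by apply: continuous_subspaceT => s; exact: cfi.
- by move: tr; rewrite ltr_norml => /andP[+ _]; lra.
- exact: cfi.
rewrite derive1E => dGE.
have /is_derive_eq : is_derive t (1 : R) (fun s => G i s - G i t0) (f t 0 i - 0).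
  apply: (@is_deriveB _ _ _ (G i) (cst (G i t0)) t 1 (f t 0 i) 0).
  by rewrite -dGE; exact: DeriveDef.
by apply; rewrite subr0.
Qed.

Variables (n : nat) (F : R -> 'rV[R]_n -> 'rV[R]_n) (L C t0 : R) (x0 : 'rV[R]_n).
Hypothesis FL : forall t x y, `|F t x - F t y| <= L * `|x - y|.
Hypothesis FC : forall t, `|F t x0| <= C.
Hypothesis Fc : forall x : R -> 'rV[R]_n, (forall t, {for t, continuous x}) ->
  forall t, {for t, continuous (fun s => F s (x s))}.

(* Clamping the time to [t0 - h, t0 + h] keeps the Picard iterates defined and
   uniformly close on the whole line, so no function space is needed. *)
Lemma picard_lindelof_global : 0 < L ->
  exists (x : R -> 'rV[R]_n) (h : R), [/\ 0 < h, x t0 = x0 &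
    forall t, `|t - t0| < h -> is_derive t (1 : R) x (F t (x t))].
Proof.
(* This makes [L * h = 1 / 2], the contraction factor of the Picard operator [T]. *)
move=> L0; pose h := (2 * L)^-1.
have h0 : 0 < h by rewrite invr_gt0 mulr_gt0.
pose cl := clamp t0 h.
have clh t : `|cl t - t0| <= h by exact: clamp_dist (ltW h0).
have cl_id t : `|t - t0| < h -> cl t = t by move=> /ltW; exact: clamp_id.
have clc t : {for t, continuous cl} by exact: clamp_continuous (ltW h0).
pose cont (x : R -> 'rV[R]_n) := forall t, {for t, continuous x}.
(* The radius is [2 * h] rather than [h], so that the derivative is also available at the endpoints
   of the clamped interval. *)
have [Int IntP] : {Int : (R -> 'rV[R]_n) -> R -> 'rV[R]_n & forall x, cont x ->
    Int x t0 = 0 /\ forall t, `|t - t0| < 2 * h -> is_derive t (1 : R) (Int x) (F t (x t))}.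
  apply: (@choice _ _ (fun x g => cont x -> g t0 = 0 /\
      forall t, `|t - t0| < 2 * h -> is_derive t (1 : R) g (F t (x t)))) => x.
  have [cx|ncx] := pselect (cont x); last by exists (fun=> 0).
  have [|g gP] := @antiderivative n (fun s => F s (x s)) t0 (2 * h) (Fc cx).
    by rewrite mulr_gt0.
  by exists g.
have IntD x t : cont x -> `|t - t0| <= h -> is_derive t (1 : R) (Int x) (F t (x t)).
  move=> cx th; have [_] := IntP x cx; apply; apply: le_lt_trans th _; lra.
pose T x t := x0 + Int x (cl t).
have Tc x : cont x -> cont (T x).
  move=> cx t; apply: cvgD; first exact: cvg_cst.
  apply: (@continuous_comp _ _ _ cl (Int x)); first exact: clc.
  exact: is_derive_continuous (IntD x (cl t) cx (clh t)).
have Tcontr x y D : cont x -> cont y -> (forall t, `|x t - y t| <= D) ->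
    forall t, `|T x t - T y t| <= D / 2.
  move=> cx cy xyD t; rewrite /T opprD addrACA subrr add0r.
  have := @mean_value_le R n (fun s => Int x s - Int y s)
    (fun s => F s (x s) - F s (y s)) t0 (cl t) (L * D).
  rewrite (IntP x cx).1 (IntP y cy).1 !subr0 => H.
  apply: le_trans (H _ _) _.
  - move=> s sh; have {}sh := le_trans sh (clh t).
    by apply: is_deriveB; exact: IntD.
  - by move=> s _; apply: le_trans (FL _ _ _) _; rewrite ler_pM2l.
  - have D0 : 0 <= D by apply: le_trans (xyD t0).
    apply: (@le_trans _ _ (L * D * h)).
      by rewrite ler_wpM2l// mulr_ge0// ltW.
    have -> // : L * D * h = D / 2.
    by rewrite /h; field; rewrite gt_eqF.
pose X m := iter m T (fun=> x0).
have Xc m : cont (X m).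
  elim: m => [t|m IH]; first exact: cvg_cst.
  exact: Tc.
have C0 : 0 <= C by apply: le_trans (FC t0).
(* The sum of the geometric series with first term [C * h], a bound for the first Picard step, and
   ratio 1/2; it satisfies [B = B / 2 + C * h]. *)
pose B := 2 * (C * h).
have B0 : 0 <= B by rewrite !mulr_ge0// ltW.
have X1 t : `|T (fun=> x0) t - x0| <= C * h.
  rewrite /T addrC addKr.
  have := @mean_value_le R n (Int (fun=> x0)) (fun s => F s x0) t0 (cl t) C.
  rewrite (IntP _ (Xc 0%N)).1 subr0 => H.
  apply: le_trans (H _ _) _ => // [s sh|].
    by apply: (IntD _ _ (Xc 0%N)); exact: le_trans sh (clh t).
  by rewrite ler_wpM2l.
have XB m j t : `|X (m + j)%N t - X m t| <= B / 2 ^+ m.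
  elim: m t => [|m IH] t.
    rewrite expr0 divr1 add0n; elim: j t => [|j IHj] t; first by rewrite subrr normr0.
    rewrite -(subrKA (T (fun=> x0) t)) (le_trans (ler_normD _ _))//.
    have -> : B = B / 2 + C * h by rewrite /B; lra.
    apply: lerD; last exact: X1.
    apply: (@Tcontr (X j) (fun=> x0)) => // u; exact: cvg_cst.
  by rewrite exprS invfM mulrCA mulrC; apply: Tcontr.
have small (e : R) : 0 < e -> exists m, B / 2 ^+ m < e.
  move=> e0; exists (Num.bound (B / e)).
  rewrite ltr_pdivrMr ?exprn_gt0// mulrC -ltr_pdivrMr//.
  apply: lt_le_trans (archi_boundP _) _; first by rewrite divr_ge0// ltW.
  by rewrite -natrX ler_nat ltnW// ltn_expl.
have Xcvg t : cvg (X m t @[m --> \oo]).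
  apply/cauchy_cvgP/cauchy_ballP => e e0; have e2 : 0 < e / 2 by rewrite divr_gt0.
  have [m mB] := small _ e2.
  have me : \forall p \near \oo, `|X p t - X m t| < e / 2.
    exists m => // p /= mp; rewrite -(subnKC mp).
    by apply: le_lt_trans (XB _ _ _) mB.
  exists ([set y | `|y - X m t| < e / 2], [set y | `|y - X m t| < e / 2]).
    by split; exact: me.
  move=> [a b] /= [ha hb]; rewrite -ball_normE/=.
  have := ler_distD (X m t) a b; rewrite (distrC (X m t) b); lra.
pose Y t := lim (X m t @[m --> \oo]).
have YX m t : `|Y t - X m t| <= B / 2 ^+ m.
  have XY : (`|X p t - X m t|) @[p --> \oo] --> `|Y t - X m t|.
    by apply: cvg_norm; apply: cvgB; [exact: Xcvg|exact: cvg_cst].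
  apply: (cvgr_to_le XY).
  by exists m => // p /= mp; rewrite -(subnKC mp).
have Yc : cont Y.
  move=> t; apply/cvgrPdist_le => e e0.
  have e3 : 0 < e / 3 by rewrite divr_gt0.
  have [m mB] := small _ e3.
  near=> s.
  have H1 := YX m t; have H2 := YX m s.
  have H3 : `|X m t - X m s| <= e / 3.
    near: s; move/cvgrPdist_le : (Xc m t); apply; exact: divr_gt0.
  have H4 := ler_distD (X m t) (Y t) (Y s).
  have H5 := ler_distD (X m s) (X m t) (Y s).
  rewrite distrC in H2; lra.
(* Compare both sides with [X m.+1 = T (X m)]: the contraction controls one distance and the rate of
   convergence the other. *)
have TY : T Y = Y.
  apply/funext => t; apply/eqP; rewrite -subr_eq0 -normr_eq0 eq_le normr_ge0 andbT.
  apply/ler_addgt0Pl => e e0; rewrite addr0.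
  have e2 : 0 < e / 2 by rewrite divr_gt0.
  have [m mB] := small _ e2.
  rewrite -(subrKA (X m.+1 t)) (le_trans (ler_normD _ _))// (splitr e) lerD//.
    apply: le_trans (@Tcontr Y (X m) (B / 2 ^+ m) Yc (Xc m) (YX m) t) _.
    have : 0 <= B / 2 ^+ m by rewrite divr_ge0.
    lra.
  rewrite distrC; apply: le_trans (YX _ _) _; apply: le_trans (ltW mB).
  rewrite ler_wpM2l// exprS invfM ler_piMl ?invr_ge0//.
  by rewrite invf_le1// ler1n.
exists Y, h; split => //.
  rewrite -TY /T cl_id ?subrr ?normr0// (IntP Y Yc).1 addr0//.
move=> t th; rewrite -{1}TY.
have : is_derive t (1 : R) (fun s => x0 + Int Y s) (0 + F t (Y t)).
  by apply: (@is_deriveD _ _ _ (cst x0) (Int Y)); apply: IntD => //; exact: ltW.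
rewrite add0r; apply: near_eq_is_derive.
have th' : 0 < h - `|t - t0| by rewrite subr_gt0.
exists (h - `|t - t0|) => //= s; rewrite /ball_/= (distrC t s) => st; rewrite /T cl_id//.
have := ler_distD t s t0; lra.
Unshelve. all: by end_near. Qed.

End Picard.

(** * Velocities of curves in manifolds *)

Lemma is_derive_comp (R : realType) (E F : normedModType R) (phi : E -> F)
    (c : R -> E) (t : R) (d : E) :
  differentiable phi (c t) -> is_derive t (1 : R) c d ->
  is_derive t (1 : R) (phi \o c) ('d phi (c t) d).
Proof.
move=> dphi dc; have dct := is_derive_differentiable dc.
apply: DeriveDef.
  by apply/derivable1_diffP; exact: differentiable_comp.
rewrite deriveE; last exact: differentiable_comp.
rewrite diff_comp//=; congr ('d phi _ _).
by rewrite -deriveE//; exact: derive_val.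
Qed.

Lemma is_derive_pair (R : realType) (E F : normedModType R) (x : R -> E)
    (y : R -> F) (t : R) (dx : E) (dy : F) :
  is_derive t (1 : R) x dx -> is_derive t (1 : R) y dy ->
  is_derive t (1 : R) (fun s => (x s, y s)) (dx, dy).
Proof.
move=> xd yd; have dxt := is_derive_differentiable xd.
have dyt := is_derive_differentiable yd.
apply: DeriveDef.
  by apply/derivable1_diffP; exact: differentiable_pair.
rewrite deriveE; last exact: differentiable_pair.
rewrite diff_pair//; congr pair.
  by rewrite -deriveE//; exact: derive_val.
by rewrite -deriveE//; exact: derive_val.
Qed.

Lemma near_eq_differentiable (R : realType) (E F : normedModType R) (f g : E -> F) x :
  (\forall y \near x, f y = g y) -> differentiable f x ->
  differentiable g x /\ forall v, 'd g x v = 'd f x v.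
Proof.
move=> fg df; have fgx : f x = g x by exact: nbhs_singleton fg.
have key : g \o shift x = cst (g x) + 'd f x +o_ 0 id.
  apply/eqaddoP => e e0; have /eqaddoP/(_ e e0) H := diff_locally df.
  have fg0 : \forall h \near 0, f (h + x) = g (h + x).
    by move: fg; rewrite (near_shift 0) subr0.
  near=> h; have : `|(f \o shift x - (cst (f x) + 'd f x)) h| <= e * `|h| by near: h.
  rewrite !fctE /= fgx /shift/=; suff -> : f (h + x) = g (h + x) by [].
  by near: h.
have dE := diff_unique (diff_continuous df) key.
split; last by move=> v; rewrite dE.
by apply/diff_locallyP; rewrite dE; split=> //; exact: diff_continuous.
Unshelve. all: by end_near. Qed.

Lemma is_derive_unique (R : realType) (E : normedModType R) (c : R -> E) (t : R) (d e : E) :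
  is_derive t (1 : R) c d -> is_derive t (1 : R) c e -> d = e.
Proof. by move=> [_ <-] [_ <-]. Qed.

Section LocalRepresentation.
Context {R : realType} {M N : topologicalType} {E F : normedModType R}.
Variables (a : chart M E) (b : chart N F).

(** These are the sets on which [smooth_map] asserts [is_Cinfty]; their openness gives access to the
    calculus of [is_Ck]. *)
Lemma open_local_domain (U : set M) (f : M -> N) : open U ->
  (forall p, U p -> {for p, continuous f}) ->
  open [set x | [/\ chart_cod a x, U (chart_inv a x)
                  & chart_dom b (f (chart_inv a x))]].
Proof.
move=> oU cf; rewrite openE => x [ax Ux bx].
have cx := chart_inv_continuous ax.
have oc : \forall y \near x, chart_cod a y by apply: open_nbhs_nbhs; split=> //; exact: chart_cod_open.
have oU' : \forall y \near x, U (chart_inv a y).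
  by apply: cx; apply: open_nbhs_nbhs.
have ob : \forall y \near x, chart_dom b (f (chart_inv a y)).
  have cfx : {for x, continuous (f \o chart_inv a)}.
    by apply: continuous_comp cx _; exact: cf.
  apply: (cfx (chart_dom b)); apply: open_nbhs_nbhs; split=> //.
  exact: chart_dom_open.
by near=> y; split; [near: y|near: y|near: y].
Unshelve. all: by end_near. Qed.

Lemma near_chart_dom (T : topologicalType) (g : T -> M) t : {for t, continuous g} ->
  chart_dom a (g t) -> \forall s \near t, chart_dom a (g s).
Proof.
move=> cg at_; apply: cg; apply: open_nbhs_nbhs; split=> //.
exact: chart_dom_open.
Qed.

(** The chain rule read in charts. Inserting [chart_inv a \o a] is legitimate only while [g] stays
    in the domain of [a], which continuity ensures near [t]. *)
Lemma is_derive_local (f : M -> N) (g : R -> M) (t : R) (d : E) :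
  {for t, continuous g} -> chart_dom a (g t) ->
  differentiable (b \o f \o chart_inv a) (a (g t)) ->
  is_derive t (1 : R) (a \o g) d ->
  is_derive t (1 : R) (b \o f \o g) ('d (b \o f \o chart_inv a) (a (g t)) d).
Proof.
move=> cg agt df dg.
apply: near_eq_is_derive (@is_derive_comp _ _ _ _ (a \o g) t d df dg).
near=> s => /=; rewrite chart_mapK//; near: s.
exact: (near_chart_dom cg agt).
Unshelve. all: by end_near. Qed.

End LocalRepresentation.

Lemma smooth_map_differentiable (R : realType) (M : topologicalType)
    (E : normedModType R) (I : finType) (c : coordinates E I) (n : nat)
    (N : topologicalType) (A : set (chart M E)) (B : set (chart N 'rV[R]_n))
    (U : set M) (f : M -> N) a b p :
  open U -> smooth_map A B U f -> A a -> B b -> U p -> chart_dom a p ->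
  chart_dom b (f p) -> differentiable (b \o f \o chart_inv a) (a p).
Proof.
move=> oU [cf sf] Aa Bb Up ap bp.
have oV := open_local_domain a b oU cf.
have [||//] := @is_Ck_differentiable R E I c n _ (b \o f \o chart_inv a) (a p) oV _ _.
  exact: sf.
by split; rewrite ?chart_mapK//; exact: chart_map_cod.
Qed.

Section Velocity.
Context {R : realType}.

(** Charts are total with arbitrary values off their domains, so a derivative of the chart reading
    alone does not keep [gamma] near [gamma t]; hence the continuity clause. The body agrees with
    the pointwise clause of [integral_curve]. *)
Definition has_velocity {n : nat} {M : manifoldType R n} (gamma : R -> M) (t : R)
    (v : 'rV[R]_n) : Prop :=
  {for t, continuous gamma} /\
  is_derive t (1 : R) (fun s => chart_at (gamma t) (gamma s)) v.

(** The condition at [p] under which [tangent_map f p] is a true derivative. Being pointwise, it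
    passes directly to the partial maps of a smooth map on a product. *)
Definition tangentiable {m n : nat} {M : manifoldType R m} {N : manifoldType R n}
    (f : M -> N) (p : M) : Prop :=
  {for p, continuous f} /\
  differentiable (chart_at (f p) \o f \o chart_inv (chart_at p)) (chart_at p p).

Lemma has_velocity_unique n (M : manifoldType R n) (g : R -> M) t v w :
  has_velocity g t v -> has_velocity g t w -> v = w.
Proof. by move=> [_ vd] [_ wd]; exact: is_derive_unique vd wd. Qed.

Lemma has_velocity_velocity n (M : manifoldType R n) (g : R -> M) t v :
  has_velocity g t v -> velocity g t = v.
Proof. by move=> [_ [_ <-]]; rewrite /velocity derive1E. Qed.

Lemma has_velocity_near n (M : manifoldType R n) (g h : R -> M) t v :
  (\forall s \near t, g s = h s) -> has_velocity g t v -> has_velocity h t v.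
Proof.
move=> gh [cg dg]; have ght : g t = h t by exact: nbhs_singleton gh.
split.
  rewrite /prop_for /continuous_at -ght; apply: cvg_trans cg.
  exact: near_eq_cvg.
rewrite -ght; apply: near_eq_is_derive dg.
by apply: filterS gh => s ->.
Qed.

Lemma has_velocity_map m n (M : manifoldType R m) (N : manifoldType R n)
    (f : M -> N) (g : R -> M) t v :
  tangentiable f (g t) -> has_velocity g t v ->
  has_velocity (f \o g) t (tangent_map f (g t) v).
Proof.
move=> [cf df] [cg dg]; split; first exact: continuous_comp.
by apply: (is_derive_local _ _ _ dg) => //; exact: chart_at_dom.
Qed.

Lemma smooth_map_tangentiable m n (M : manifoldType R m) (N : manifoldType R n)
    (f : M -> N) p :
  smooth_map (atlas M) (atlas N) setT f -> tangentiable f p.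
Proof.
move=> sf; split; first by case: sf => + _; apply.
by apply: (smooth_map_differentiable (rV_coordinates m) openT sf) => //;
  [exact: chart_at_atlas|exact: chart_at_atlas|exact: chart_at_dom|exact: chart_at_dom].
Qed.

Lemma tangentiable_comp l m n (L : manifoldType R l) (M : manifoldType R m)
    (N : manifoldType R n) (f : M -> N) (g : L -> M) p :
  tangentiable g p -> tangentiable f (g p) -> tangentiable (f \o g) p /\
  forall v, tangent_map (f \o g) p v = tangent_map f (g p) (tangent_map g p v).
Proof.
move=> [cg dg] [cf df].
have nE : \forall x \near chart_at p p,
   ((chart_at (f (g p)) \o f \o chart_inv (chart_at (g p))) \o
    (chart_at (g p) \o g \o chart_inv (chart_at p))) x =
   (chart_at (f (g p)) \o (f \o g) \o chart_inv (chart_at p)) x.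
  near=> x => /=; rewrite chart_mapK//; near: x.
  apply: (@near_chart_dom _ _ _ (chart_at (g p)) _ (g \o chart_inv (chart_at p)));
    last by rewrite /= chart_mapK; exact: chart_at_dom.
  apply: continuous_comp; last by rewrite chart_mapK//; exact: chart_at_dom.
  by apply: chart_inv_continuous; apply: chart_map_cod; exact: chart_at_dom.
set G := chart_at (g p) \o g \o chart_inv (chart_at p) in dg nE *.
set F := chart_at (f (g p)) \o f \o chart_inv (chart_at (g p)) in df nE *.
have GE : G (chart_at p p) = chart_at (g p) (g p).
  by rewrite /G /= chart_mapK//; exact: chart_at_dom.
have dF : differentiable F (G (chart_at p p)) by rewrite GE.
have [d1 d2] := near_eq_differentiable nE (differentiable_comp dg dF).
split; first by split; [exact: continuous_comp|exact: d1].
move=> v; rewrite /tangent_map d2 (diff_comp dg dF).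
by rewrite -/F -/G -GE.
Unshelve. all: by end_near. Qed.

End Velocity.

Section ProductVelocity.
Context {R : realType} {l m n : nat}.
Context {L : manifoldType R l} {M : manifoldType R m} {N : manifoldType R n}.
Variable f : L * M -> N.
Hypothesis sf : smooth_map (prod_atlas (atlas L) (atlas M)) (atlas N) setT f.

Lemma pair_continuous (S T U : topologicalType) (x : S -> T) (y : S -> U) s :
  {for s, continuous x} -> {for s, continuous y} -> {for s, continuous (fun s => (x s, y s))}.
Proof.
by move=> cx cy; apply: (@cvg_pair _ _ _ _ (nbhs (x s)) (nbhs (y s))).
Qed.

Let rep p q := chart_at (f (p, q)) \o f \o chart_inv (prod_chart (chart_at p) (chart_at q)).

Lemma rep_differentiable p q : differentiable (rep p q) (chart_at p p, chart_at q q).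
Proof.
apply: (@smooth_map_differentiable R _ _ _
  (prod_coordinates (rV_coordinates l) (rV_coordinates m)) n _ _ _ setT f
  (prod_chart (chart_at p) (chart_at q)) (chart_at (f (p, q))) (p, q) openT sf) => //.
- by exists (chart_at p), (chart_at q); split => //; exact: chart_at_atlas.
- exact: chart_at_atlas.
- by split; exact: chart_at_dom.
- exact: chart_at_dom.
Qed.

(** A partial map is [rep p q] after the inclusion of a slice. Expressing both partial tangent maps
    by the same differential turns their sum into its value at [(v, w)]. *)
Lemma tangentiable_fst p q : tangentiable (fun p' => f (p', q)) p /\
  forall v, tangent_map (fun p' => f (p', q)) p v =
    'd (rep p q) (chart_at p p, chart_at q q) (v, 0).
Proof.
have cf : {for (p, q), continuous f} by case: sf => + _; apply.
have E : chart_at (f (p, q)) \o (fun p' => f (p', q)) \o chart_inv (chart_at p) =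
    rep p q \o (fun x => (id x, cst (chart_at q q) x)).
  by apply/funext => x; rewrite /rep /= chart_mapK//; exact: chart_at_dom.
have di : differentiable (fun x : 'rV[R]_l => (id x, cst (chart_at q q) x)) (chart_at p p).
  by apply: differentiable_pair.
have dr := rep_differentiable p q.
split; [split|].
- apply: (@continuous_comp _ _ _ (fun p' => (p', q)) f) cf.
  by apply: pair_continuous; [exact: cvg_id|exact: cvg_cst].
- by rewrite E; exact: differentiable_comp.
- move=> v; rewrite /tangent_map E (diff_comp di dr) /=.
  congr ('d _ _ _); rewrite diff_pair//; congr pair.
    by rewrite diff_val.
  by rewrite diff_val.
Qed.

Lemma tangentiable_snd p q : tangentiable (fun q' => f (p, q')) q /\
  forall v, tangent_map (fun q' => f (p, q')) q v =
    'd (rep p q) (chart_at p p, chart_at q q) (0, v).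
Proof.
have cf : {for (p, q), continuous f} by case: sf => + _; apply.
have E : chart_at (f (p, q)) \o (fun q' => f (p, q')) \o chart_inv (chart_at q) =
    rep p q \o (fun x => (cst (chart_at p p) x, id x)).
  by apply/funext => x; rewrite /rep /= chart_mapK//; exact: chart_at_dom.
have di : differentiable (fun x : 'rV[R]_m => (cst (chart_at p p) x, id x)) (chart_at q q).
  by apply: differentiable_pair.
have dr := rep_differentiable p q.
split; [split|].
- apply: (@continuous_comp _ _ _ (fun q' => (p, q')) f) cf.
  by apply: pair_continuous; [exact: cvg_cst|exact: cvg_id].
- by rewrite E; exact: differentiable_comp.
- move=> v; rewrite /tangent_map E (diff_comp di dr) /=.
  congr ('d _ _ _); rewrite diff_pair//; congr pair.
    by rewrite diff_val.
  by rewrite diff_val.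
Qed.

(** The Leibniz rule behind all later velocity computations, for the group multiplication as well as
    for the action. *)
Lemma has_velocity_map2 (x : R -> L) (y : R -> M) t v w :
  has_velocity x t v -> has_velocity y t w ->
  has_velocity (fun s => f (x s, y s)) t
    (tangent_map (fun p => f (p, y t)) (x t) v + tangent_map (fun q => f (x t, q)) (y t) w).
Proof.
move=> [cx dx] [cy dy].
have cxy := pair_continuous cx cy.
split.
  apply: (@continuous_comp _ _ _ (fun s => (x s, y s)) f) => //.
  by case: sf => + _; apply.
rewrite (tangentiable_fst _ _).2 (tangentiable_snd _ _).2 -linearD.
have -> : (v, 0) + (0, w) = (v, w) :> 'rV[R]_l * 'rV[R]_m.
  by congr pair; rewrite /= ?addr0 ?add0r.
apply: (@is_derive_local _ _ _ _ _ (prod_chart (chart_at (x t)) (chart_at (y t)))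
   (chart_at (f (x t, y t))) f (fun s => (x s, y s)) t (v, w)) => //.
- by split; exact: chart_at_dom.
- exact: rep_differentiable.
- exact: is_derive_pair.
Qed.

End ProductVelocity.

Section ChartChange.
Context {R : realType} {n : nat} {M : manifoldType R n}.

Lemma smooth_map_id : smooth_map (atlas M) (atlas M) setT id.
Proof.
split=> [p _|a b Aa Ab]; first exact: cvg_id.
move=> k; have := atlas_compatible a b Aa Ab k.
by apply: is_Ck_sub => x [ax _ bx]; split.
Qed.

Lemma has_velocity_chart (b : chart M 'rV[R]_n) (g : R -> M) t v :
  atlas M b -> chart_dom b (g t) -> has_velocity g t v ->
  is_derive t (1 : R) (b \o g) (chart_coord b (g t) v).
Proof.
move=> Ab bg [cg dg].
apply: (@is_derive_local _ _ _ _ _ (chart_at (g t)) b id g t v) => //.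
  exact: chart_at_dom.
apply: (smooth_map_differentiable (rV_coordinates n) openT smooth_map_id) => //.
  exact: chart_at_atlas.
exact: chart_at_dom.
Qed.

Lemma chart_has_velocity (b : chart M 'rV[R]_n) (g : R -> M) t y :
  atlas M b -> chart_dom b (g t) -> {for t, continuous g} ->
  is_derive t (1 : R) (b \o g) y ->
  has_velocity g t ('d (chart_at (g t) \o chart_inv b) (b (g t)) y).
Proof.
move=> Ab bg cg dg; split=> //.
apply: (@is_derive_local _ _ _ _ _ b (chart_at (g t)) id g t y) => //.
apply: (smooth_map_differentiable (rV_coordinates n) openT smooth_map_id) => //.
  exact: chart_at_atlas.
exact: chart_at_dom.
Qed.

Lemma smooth_curve_has_velocity (J : set R) (g : R -> M) t :
  open J -> J t -> smooth_curve J g -> has_velocity g t (velocity g t).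
Proof.
move=> oJ Jt [cg sg]; split; first exact: cg.
have [_ /(_ 1)[+ _]] := sg (id_chart R^o) (chart_at (g t)) erefl (chart_at_atlas _) 1%N.
move=> /(_ t) dg; rewrite /velocity derive1E; apply: derivableP; apply: dg.
by split=> //; exact: chart_at_dom.
Qed.

End ChartChange.

Section VelocityTheory.
Context {R : realType}.

Lemma tangent_map0 m n (M : manifoldType R m) (N : manifoldType R n) (f : M -> N) p :
  tangent_map f p 0 = 0.
Proof. by rewrite /tangent_map linear0. Qed.

Lemma tangent_mapD m n (M : manifoldType R m) (N : manifoldType R n) (f : M -> N) p v w :
  tangent_map f p (v + w) = tangent_map f p v + tangent_map f p w.
Proof. by rewrite /tangent_map linearD. Qed.

Lemma tangent_mapN m n (M : manifoldType R m) (N : manifoldType R n) (f : M -> N) p v :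
  tangent_map f p (- v) = - tangent_map f p v.
Proof. by rewrite /tangent_map linearN. Qed.

(* Identities between tangent maps are proved below by computing the velocity of
   one curve in two ways. *)
Lemma exists_velocity n (M : manifoldType R n) (p : M) v :
  exists2 g : R -> M, g 0 = p & has_velocity g 0 v.
Proof.
pose c := chart_at p; pose l (s : R) := c p + s *: v.
have cp : chart_dom c p := chart_at_dom p.
have l0 : l 0 = c p by rewrite /l scale0r addr0.
have dl : is_derive (0 : R) (1 : R) l v by exact: is_derive_affine.
have cl : {for 0, continuous l} by exact: is_derive_continuous dl.
have g0 : (chart_inv c \o l) 0 = p by rewrite /= l0 chart_mapK.
exists (chart_inv c \o l) => //; split.
  apply: continuous_comp => //; rewrite l0; apply: chart_inv_continuous.
  exact: chart_map_cod.
rewrite g0; apply: near_eq_is_derive dl.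
near=> s => /=; rewrite chart_invK//; near: s; apply: (cl (chart_cod c)).
apply: open_nbhs_nbhs; split; first exact: chart_cod_open.
by rewrite l0; exact: chart_map_cod.
Unshelve. all: by end_near. Qed.

Lemma tangent_map_id n (M : manifoldType R n) (p : M) v : tangent_map id p v = v.
Proof.
have [g <- gv] := exists_velocity p v.
have := has_velocity_map (smooth_map_tangentiable (g 0) (@smooth_map_id _ _ M)) gv.
by move=> gv'; exact: has_velocity_unique gv' gv.
Qed.

(** The two coordinate changes between [b] and [chart_at (g t)] are inverse on vectors; this is
    tested on an auxiliary curve with velocity [v]. *)
Lemma chart_coord_has_velocity n (M : manifoldType R n) (b : chart M 'rV[R]_n)
    (g : R -> M) t v :
  atlas M b -> chart_dom b (g t) -> {for t, continuous g} ->
  is_derive t (1 : R) (b \o g) (chart_coord b (g t) v) -> has_velocity g t v.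
Proof.
move=> Ab bg cg dg; have := chart_has_velocity Ab bg cg dg.
suff -> : 'd (chart_at (g t) \o chart_inv b) (b (g t)) (chart_coord b (g t) v) = v by [].
have [h h0 hv] := exists_velocity (g t) v; rewrite -h0 in bg *.
have hb := has_velocity_chart Ab bg hv.
exact: (has_velocity_unique (chart_has_velocity Ab bg hv.1 hb) hv).
Qed.

Lemma has_velocity_affine n (M : manifoldType R n) (g : R -> M) (a r t : R) v :
  has_velocity g (a + r * t) v -> has_velocity (fun s => g (a + r * s)) t (r *: v).
Proof.
pose l (s : R) : R := a + r * s.
have dl : is_derive t (1 : R) l r.
  have -> : l = fun s => a + s *: r by apply/funext => s; rewrite /l mulrC.
  exact: is_derive_affine.
have cl : {for t, continuous l} by exact: is_derive_continuous dl.
move=> [cg dg]; split.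
  exact: (@continuous_comp _ _ _ l g).
have dG : differentiable (fun s => chart_at (g (l t)) (g s)) (l t).
  exact: is_derive_differentiable dg.
have := is_derive_comp dG dl.
rewrite -[r in 'd _ _ r]mulr1 -[r * 1]/(r *: 1) linearZ/= -deriveE//.
by rewrite (@derive_val _ _ _ _ _ _ _ dg).
Qed.

(** The mean value inequality with constant 0, on a ball of times during which the curve stays in
    one chart. *)
Lemma velocity0_locally_constant n (M : manifoldType R n) (J : set R) (g : R -> M) t :
  open J -> (forall s, J s -> has_velocity g s 0) -> J t ->
  \forall s \near t, g s = g t.
Proof.
move=> oJ gv Jt; pose c := chart_at (g t).
have : \forall s \near t, J s /\ chart_dom c (g s).
  near=> s; split; near: s; first exact: open_nbhs_nbhs.
  exact: (near_chart_dom (gv _ Jt).1 (chart_at_dom _)).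
case/nbhs_normP => e /= e0 H; exists e => //= s st.
have Hs u : `|u - t| <= `|s - t| -> J u /\ chart_dom c (g u).
  move=> us; apply: H; rewrite /ball_/= distrC.
  by apply: le_lt_trans us _; rewrite distrC.
have := @mean_value_le R n (c \o g) (fun=> 0) t s 0.
rewrite mul0r => mv.
have cE : c (g s) = c (g t).
  apply/eqP; rewrite -subr_eq0 -normr_le0; apply: mv => u /Hs[Ju cu]; last by rewrite normr0.
  have := has_velocity_chart (chart_at_atlas _) cu (gv u Ju).
  by rewrite /chart_coord linear0.
have [_ cs] := Hs s (lexx _).
by rewrite -(chart_mapK cs) -(chart_mapK (chart_at_dom (g t))); congr (chart_inv c _).
Unshelve. all: by end_near. Qed.

(** Both the level set of the value [g s] and its complement in the connected set [J] are open. *)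
Lemma velocity0_constant n (M : manifoldType R n) (J : set R) (g : R -> M) s t :
  open J -> is_interval J -> (forall u, J u -> has_velocity g u 0) -> J s -> J t ->
  g s = g t.
Proof.
move=> oJ iJ gv Js Jt.
pose A := [set u | J u /\ g u = g s]; pose B := [set u | J u /\ g u <> g s].
have op (P : M -> Prop) : open [set u | J u /\ P (g u)].
  rewrite openE => u [Ju Pu].
  have := velocity0_locally_constant oJ gv Ju.
  have : \forall v \near u, J v by exact: open_nbhs_nbhs.
  by apply: filterS2 => v Jv vE; split=> //; rewrite vE.
have cJ : connected J by apply/connected_intervalP.
suff : A = J by move=> AJ; have [_ ->] : A t by rewrite AJ.
apply: cJ.
- by exists s.
- exists A; first exact: (op (fun p => p = g s)).
  by apply/seteqP; split=> u; rewrite /A/= => -[]; [move=> ? ?; split|].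
- exists (~` B); first exact: open_closedC (op (fun p => p <> g s)).
  apply/seteqP; split=> u; rewrite /A /B/=.
    by move=> [Ju gu]; split=> // -[].
  by move=> [Ju nB]; split=> //; apply: contrapT => gu; exact: nB.
Qed.

End VelocityTheory.

(** * Left-invariant differential equations on a Lie group *)

Section LeftInvariantODE.
Context {R : realType} {k : nat} {G : lieGroupType R k}.
Implicit Types (g h q : G) (v w : 'rV[R]_k).

Definition left_field g w : 'rV[R]_k := tangent_map (fun h : G => (g * h)%g) (1%g : G) w.

Definition left_solution (w : R -> 'rV[R]_k) (g : R -> G) (t : R) : Prop :=
  has_velocity g t (left_field (g t) (w t)).

Lemma mulg_tangentiable_r g h : tangentiable (fun x : G => (g * x)%g) h.
Proof. exact: (tangentiable_snd mulg_smooth g h).1. Qed.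

Lemma mulg_tangentiable_l g h : tangentiable (fun x : G => (x * g)%g) h.
Proof. exact: (tangentiable_fst mulg_smooth h g).1. Qed.

(** Left invariance, by the chain rule for the composite of the translations by [g] and [q]. *)
Lemma tangent_map_mulg q g w :
  tangent_map (fun x : G => (q * x)%g) g (left_field g w) = left_field (q * g)%g w.
Proof.
have t1 := mulg_tangentiable_r g 1%g; have := mulg_tangentiable_r q (g * 1)%g.
move=> /(tangentiable_comp t1)[_ /(_ w)]; rewrite /left_field mulg1 => <-.
have -> // : (fun x : G => (q * x)%g) \o (fun x : G => (g * x)%g) = (fun x => (q * g * x)%g).
by apply/funext => x; exact: mulgA.
Qed.

Lemma left_field1 w : left_field 1%g w = w.
Proof.
rewrite /left_field; have -> : (fun h : G => (1 * h)%g) = id.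
  by apply/funext => h; rewrite mul1g.
exact: tangent_map_id.
Qed.

Lemma left_solution_mulg (w : R -> 'rV[R]_k) (g : R -> G) q t :
  left_solution w g t -> left_solution w (fun s => (q * g s)%g) t.
Proof.
move=> gs; rewrite /left_solution -tangent_map_mulg.
exact: (has_velocity_map (mulg_tangentiable_r q (g t)) gs).
Qed.

(* The quotient of two solutions has zero velocity, so no Gronwall estimate is
   needed. *)
Lemma left_solution_unique (J : set R) (w : R -> 'rV[R]_k) (g h : R -> G) s t :
  open J -> is_interval J ->
  (forall u, J u -> left_solution w g u) -> (forall u, J u -> left_solution w h u) ->
  J s -> J t -> (g s * (h s)^-1)%g = (g t * (h t)^-1)%g.
Proof.
move=> oJ iJ gs hs; pose q u := (g u * (h u)^-1)%g.
suff q0 u : J u -> has_velocity q u 0.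
  by move=> Js Jt; apply: (@velocity0_constant _ _ _ J q).
move=> Ju.
have hi := has_velocity_map (smooth_map_tangentiable (h u) invg_smooth) (hs u Ju).
have := has_velocity_map2 mulg_smooth (gs u Ju) hi.
set v := (X in has_velocity _ _ X); rewrite -/q => qv.
(* Differentiate [q * h = g]. The term coming from [h] is already the velocity of [g], so the image
   of [v] under right translation by [h u] is 0. *)
have /= := has_velocity_map2 mulg_smooth qv (hs u Ju).
have -> : (fun s => q s * h s)%g = g.
  by apply/funext => x; rewrite /q -mulgA mulVg mulg1.
move=> gv; have := has_velocity_unique gv (gs u Ju).
rewrite tangent_map_mulg; have -> : (q u * h u)%g = g u.
  by rewrite /q -mulgA mulVg mulg1.
move=> /(canRL (addrK _)); rewrite subrr => v0.
suff -> : 0 = v by [].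
(* Right translation by [h u] has an inverse, so [v] itself vanishes. *)
have tl := mulg_tangentiable_l (h u) (q u).
have := mulg_tangentiable_l (h u)^-1%g (q u * h u)%g.
move=> /(tangentiable_comp tl)[_ /(_ v)]; rewrite v0 tangent_map0 => <-.
have -> : (fun x : G => (x * (h u)^-1)%g) \o (fun x : G => (x * h u)%g) = id.
  by apply/funext => x /=; rewrite -mulgA mulgV mulg1.
exact: tangent_map_id.
Qed.

End LeftInvariantODE.

(** * Local existence of solutions in a chart at the identity *)

Section LocalLipschitz.
Context {R : realType}.

Lemma is_Ck1_lipschitz (E : normedModType R) (I : finType) (c : coordinates E I) n
    (U : set E) (f : E -> 'rV[R]_n) z0 :
  open U -> is_Ck 1 U f -> U z0 ->
  exists rL : R * R, [/\ 0 < rL.1, 0 <= rL.2 & forall z z',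
    `|z - z0| <= rL.1 -> `|z' - z0| <= rL.1 -> `|f z - f z'| <= rL.2 * `|z - z'|].
Proof.
move=> oU fk Uz0; have df z : U z -> _ := fun Uz => is_Ck_differentiable c oU fk Uz.
pose B i := `|'D_(cvec c i) f z0| + 1.
have : \forall z \near z0, U z /\ forall i, `|'D_(cvec c i) f z| <= B i.
  near=> z; split; first by near: z; exact: open_nbhs_nbhs.
  near: z; apply: filter_forall => i.
  have cD : {for z0, continuous ('D_(cvec c i) f)} by apply: (fk.2 (cvec c i)).2.1.
  move/cvgrPdist_le : cD => /(_ 1 ltr01); apply: filterS => z.
  rewrite distrC => z1; rewrite /B.
  rewrite -[X in `|X|](subrK ('D_(cvec c i) f z0)) (le_trans (ler_normD _ _))//.
  by rewrite addrC lerD2l.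
case/nbhs_normP => e /= e0 H.
(* [mean_value_le] ranges over all [s] with [|s| <= 1], negative ones included, so the points
   [s *: (z - z') + z'] stray up to three quarters of [e] from [z0]. *)
have e4 : 0 < e / 4 by rewrite divr_gt0.
have L0 : 0 <= \sum_i B i by apply: sumr_ge0 => i _; rewrite /B addr_ge0.
exists (e / 4, \sum_i B i); split=> //= z z' zr z'r.
have seg (s : R) : `|s - 0| <= `|1 - 0| -> U (s *: (z - z') + z') /\
    forall i, `|'D_(cvec c i) f (s *: (z - z') + z')| <= B i.
  rewrite !subr0 normr1 => s1; apply: H; rewrite /ball_/= distrC.
  rewrite -addrA (le_lt_trans (ler_normD _ _))// normrZ.
  have : `|z - z'| <= e / 4 + e / 4.
    by apply: le_trans (ler_distD z0 _ _) _; rewrite lerD// distrC.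
  move=> zz'; have : `|s| * `|z - z'| <= 1 * (e / 4 + e / 4) by rewrite ler_pM.
  lra.
suff : `|f (1 *: (z - z') + z') - f (0 *: (z - z') + z')| <=
    (\sum_i B i) * `|z - z'| * `|1 - 0|.
  by rewrite scale1r subrK scale0r add0r subr0 normr1 mulr1.
apply: (@mean_value_le R n (fun s => f (s *: (z - z') + z'))
  (fun s => 'D_(z - z') f (s *: (z - z') + z'))) => s /seg[Us sB].
  by apply: is_derive_line; apply: diff_derivable; exact: (df _ Us).1.
rewrite deriveE; last exact: (df _ Us).1.
rewrite (df _ Us).2 (le_trans (ler_norm_sum _ _ _))// mulr_suml ler_sum// => i _.
by rewrite normrZ mulrC ler_pM// coor_le.
Unshelve. all: by end_near. Qed.

(** A 1-Lipschitz retraction onto the closed ball of the max norm; composing with it makes a locally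
    Lipschitz field globally Lipschitz. *)
Definition clamp_rV n (x0 : 'rV[R]_n) (r : R) (x : 'rV[R]_n) : 'rV[R]_n :=
  \row_i clamp (x0 0 i) r (x 0 i).

Lemma clamp_rV_dist n (x0 : 'rV[R]_n) r x : 0 <= r -> `|clamp_rV x0 r x - x0| <= r.
Proof. by move=> r0; apply: rV_norm_le => // i; rewrite !mxE clamp_dist. Qed.

Lemma clamp_rV_id n (x0 : 'rV[R]_n) r x : `|x - x0| <= r -> clamp_rV x0 r x = x.
Proof.
move=> xr; apply/rowP => i; rewrite mxE clamp_id//.
by have := coord_le_norm (x - x0) i; rewrite !mxE => /le_trans; exact.
Qed.

Lemma clamp_rV_lipschitz n (x0 : 'rV[R]_n) r x y : 0 <= r ->
  `|clamp_rV x0 r x - clamp_rV x0 r y| <= `|x - y|.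
Proof.
move=> r0; apply: rV_norm_le => // i; rewrite !mxE.
apply: le_trans (clamp_lipschitz _ _ _ r0) _.
by have := coord_le_norm (x - y) i; rewrite !mxE.
Qed.

Lemma lipschitz_continuous (E F : normedModType R) (f : E -> F) (L : R) x : 0 <= L ->
  (forall y z, `|f y - f z| <= L * `|y - z|) -> {for x, continuous f}.
Proof.
move=> L0 fL; apply/cvgrPdist_lt => e e0.
have L1 : 0 < L + 1 by rewrite ltr_wpDl.
near=> y; apply: (@le_lt_trans _ _ ((L + 1) * `|x - y|)).
  by apply: le_trans (fL _ _) _; rewrite ler_wpM2r// lerDl.
rewrite mulrC -ltr_pdivlMr//; near: y.
by apply/nbhs_normP; exists (e / (L + 1)) => //=; rewrite divr_gt0.
Unshelve. all: by end_near. Qed.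

End LocalLipschitz.

Section LocalExistence.
Context {R : realType} {k : nat} {G : lieGroupType R k}.

Let e : chart G 'rV[R]_k := chart_at (1%g : G).
Let mul (gh : G * G) : G := (gh.1 * gh.2)%g.

Definition mul_rep (b : chart G 'rV[R]_k) : 'rV[R]_k * 'rV[R]_k -> 'rV[R]_k :=
  b \o mul \o chart_inv (prod_chart b e).

(** Written exactly as the domain in [smooth_map], so that [mulg_smooth] applies as it stands. *)
Definition mul_dom (b : chart G 'rV[R]_k) :=
  [set x | [/\ chart_cod (prod_chart b e) x, [set: G * G] (chart_inv (prod_chart b e) x)
             & chart_dom b (mul (chart_inv (prod_chart b e) x))]].

Let e1 : chart_dom e (1%g : G) := chart_at_dom _.

Lemma open_mul_dom b : open (mul_dom b).
Proof. by apply: open_local_domain; [exact: openT|case: (@mulg_smooth R k G)]. Qed.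

Lemma mul_rep_smooth b : atlas G b -> is_Cinfty (mul_dom b) (mul_rep b).
Proof.
move=> Ab; have [_ +] := @mulg_smooth R k G; apply => //.
by exists b, e; split=> //; exact: chart_at_atlas.
Qed.

Lemma mul_dom_chart b h : chart_dom b h -> mul_dom b (b h, e (1%g : G)).
Proof.
move=> bh; split=> //=.
  by split; exact: chart_map_cod.
by rewrite /mul /= !chart_mapK// mulg1.
Qed.

(* The left-invariant vector field of the [j]-th basis vector, read in [b]. *)
Definition mul_field b j (x : 'rV[R]_k) : 'rV[R]_k :=
  'D_((0 : 'rV[R]_k, delta_mx 0 j : 'rV[R]_k)) (mul_rep b) (x, e (1%g : G)).

(** The left-invariant field is the partial differential of the multiplication in its second
    argument at 1. This separates [w] from the base point and lets the coefficients inherit their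
    smoothness from [mulg_smooth]. *)
Lemma left_field_chart b h w : atlas G b -> chart_dom b h ->
  chart_coord b h (left_field h w) = \sum_j w 0 j *: mul_field b j (b h).
Proof.
move=> Ab bh; have [c c1 cw] := exists_velocity (1%g : G) w.
have [drep repE] := is_Ck_differentiable
  (prod_coordinates (rV_coordinates k) (rV_coordinates k))
  (@open_mul_dom b) (mul_rep_smooth Ab 1) (mul_dom_chart bh).
transitivity ('d (mul_rep b) (b h, e (1%g : G)) (0, w)); last first.
  rewrite repE big_sumType.
  rewrite -[RHS]add0r; apply: (f_equal2 +%R).
    apply: big1 => i _; rewrite -[coor _ _ _]/((0 : 'rV[R]_k) 0 i).
    by rewrite mxE scale0r.
  by apply: eq_bigr.
have dw : is_derive 0 (1 : R) (e \o c) w by case: cw => _; rewrite c1.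
have hw : has_velocity (fun s => (h * c s)%g) 0 (left_field h w).
  have := mulg_tangentiable_r h (c 0) => /has_velocity_map/(_ cw).
  by rewrite c1.
have bhw := @has_velocity_chart _ _ _ b (fun s => (h * c s)%g) 0 (left_field h w) Ab _ hw.
rewrite c1 mulg1 in bhw.
apply: is_derive_unique (bhw bh) _.
have := @is_derive_local R _ _ _ _ (prod_chart b e) b mul (fun s => (h, c s)) 0 (0, w).
rewrite /= c1; apply => //.
- by apply: pair_continuous; [exact: cvg_cst|exact: cw.1].
- exact: (@is_derive_pair R _ _ (cst (b h)) (e \o c) 0 0 w (is_derive_cst _ _ _) dw).
Qed.

End LocalExistence.

Section LocalSolution.
Context {R : realType} {k : nat} {G : lieGroupType R k}.

Let e : chart G 'rV[R]_k := chart_at (1%g : G).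
Let x0 : 'rV[R]_k := e (1%g : G).
Let e1 : chart_dom e (1%g : G) := chart_at_dom _.

Lemma mul_field_lipschitz : exists (r : R) (L : 'I_k -> R), 0 < r /\
  forall j, 0 <= L j /\ forall x y, `|x - x0| <= r -> `|y - x0| <= r ->
    `|mul_field e j x - mul_field e j y| <= L j * `|x - y|.
Proof.
have H j : exists rL : R * R, [/\ 0 < rL.1, 0 <= rL.2 & forall x y,
    `|x - x0| <= rL.1 -> `|y - x0| <= rL.1 ->
    `|mul_field e j x - mul_field e j y| <= rL.2 * `|x - y|].
  (* Order 2, because [mul_field] is already a derivative of [mul_rep] and has to be C^1 itself. *)
  have [_ /(_ (0, delta_mx 0 j))[_ fk]] := mul_rep_smooth (chart_at_atlas (1%g : G)) 2.
  have [[r L] [r0 L0 rL]] := is_Ck1_lipschitz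
    (prod_coordinates (rV_coordinates k) (rV_coordinates k))
    (@open_mul_dom _ _ _ e) fk (mul_dom_chart e1).
  have nE (x y : 'rV[R]_k) : `|((x, x0) : 'rV[R]_k * 'rV[R]_k) - (y, x0)| = `|x - y|.
    rewrite prod_normE/=; have -> : x0 - x0 = 0 by rewrite subrr.
    by rewrite normr0; apply/max_idPl.
  exists (r, L); split=> // x y xr yr.
  by have := rL (x, x0) (y, x0); rewrite !nE; apply.
have [rL rLP] := choice H.
(* The default 1 keeps the common radius positive even when [k = 0]. *)
exists (\big[Num.min/1]_j (rL j).1), (fun j => (rL j).2); split.
  by apply: lt_bigmin => // j _; case: (rLP j).
move=> j; have [_ L0 lip] := rLP j; split=> // x y xr yr; apply: lip.
  by apply: le_trans xr _; exact: (bigmin_le 1 j (fun j => (rL j).1)).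
by apply: le_trans yr _; exact: (bigmin_le 1 j (fun j => (rL j).1)).
Qed.

(** In the chart at 1, space is clamped to a ball where the fields are Lipschitz and time to an
    interval where [w] is bounded. Picard-Lindelof then applies globally, and its solution is kept
    only while no clamp acts. Other initial values are reached by left translation. *)
Lemma left_solution_local (J : set R) (w : R -> 'rV[R]_k) t0 :
  open J -> J t0 -> (forall t, J t -> {for t, continuous w}) ->
  exists (g : R -> G) (d : R), [/\ 0 < d, g t0 = 1%g &
    forall t, `|t - t0| < d -> J t /\ left_solution w g t].
Proof.
move=> oJ Jt0 cw.
have [r [L [r0 LP]]] := mul_field_lipschitz.
have : \forall t \near t0, J t /\ `|w t| <= `|w t0| + 1.
  near=> t; split; first by near: t; exact: open_nbhs_nbhs.
  near: t; move/cvgrPdist_le : (cw _ Jt0) => /(_ 1 ltr01); apply: filterS => t.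
  rewrite distrC => t1; rewrite -[X in `|X|](subrK (w t0)) (le_trans (ler_normD _ _))//.
  by rewrite addrC lerD2l.
case/nbhs_normP => p /= p0 H.
pose rho := p / 2; have rho0 : 0 < rho by rewrite divr_gt0.
have Hrho t : `|t - t0| <= rho -> J t /\ `|w t| <= `|w t0| + 1.
  move=> tr; apply: H; rewrite /ball_/= distrC; apply: le_lt_trans tr _.
  by rewrite /rho ltr_pdivrMr// ltr_pMr// ltr1n.
pose cl := clamp t0 rho.
have clr t : `|cl t - t0| <= rho by exact: clamp_dist (ltW rho0).
pose W := `|w t0| + 1; have W0 : 0 <= W by rewrite addr_ge0.
pose V j x := mul_field e j (clamp_rV x0 r x).
have VL j x y : `|V j x - V j y| <= L j * `|x - y|.
  have [L0 lip] := LP j.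
  apply: le_trans (lip _ _ (clamp_rV_dist _ _ (ltW r0)) (clamp_rV_dist _ _ (ltW r0))) _.
  by rewrite ler_wpM2l// clamp_rV_lipschitz// ltW.
pose F t x := \sum_j (w (cl t) 0 j) *: V j x.
have wW t j : `|w (cl t) 0 j| <= W.
  by apply: le_trans (coord_le_norm _ _) _; have [] := Hrho _ (clr t).
(* The summand 1 provides the strict positivity that [picard_lindelof_global] asks for. *)
pose LF := \sum_j W * L j + 1.
have LF0 : 0 < LF.
  rewrite /LF ltr_wpDl// sumr_ge0// => j _; rewrite mulr_ge0//.
  by case: (LP j).
have FL t x y : `|F t x - F t y| <= LF * `|x - y|.
  rewrite /F -sumrB (le_trans (ler_norm_sum _ _ _))//.
  apply: (@le_trans _ _ ((\sum_j W * L j) * `|x - y|)); last first.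
    by rewrite ler_wpM2r// lerDl.
  rewrite mulr_suml ler_sum// => j _; rewrite -scalerBr normrZ -mulrA.
  by rewrite ler_pM.
have FC t : `|F t x0| <= \sum_j W * `|V j x0|.
  rewrite /F (le_trans (ler_norm_sum _ _ _))// ler_sum// => j _.
  by rewrite normrZ ler_wpM2r.
have Fc (x : R -> 'rV[R]_k) : (forall t, {for t, continuous x}) ->
    forall t, {for t, continuous (fun s => F s (x s))}.
  move=> cx t; rewrite /F.
  have cwcl : {for t, continuous (w \o cl)}.
    apply: continuous_comp; first exact: clamp_continuous (ltW rho0).
    by apply: cw; have [] := Hrho _ (clr t).
  apply: continuous_sum => j.
  apply: (@continuous_scale R R _ (fun u => w (cl u) 0 j) (V j \o x)).
    apply: (@continuous_comp _ _ _ (w \o cl) (fun y : 'rV[R]_k => y 0 j)) => //.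
    exact: coord_continuous.
  apply: continuous_comp; first exact: cx.
  by apply: (lipschitz_continuous (LP j).1); exact: VL.
have [x [h [h0 xt0 dx]]] := picard_lindelof_global t0 FL FC Fc LF0.
have cx t : `|t - t0| < h -> {for t, continuous x}.
  by move=> /dx; exact: is_derive_continuous.
have cxt0 : {for t0, continuous x} by apply: cx; rewrite subrr normr0.
(* At these times both clamps are the identity and [x t] is the chart reading of a group element. *)
have : \forall t \near t0, [/\ `|t - t0| < h, `|t - t0| <= rho, `|x t - x0| <= r
    & chart_cod e (x t)].
  near=> t; split.
  - near: t; apply/nbhs_normP; exists h => // t /=; by rewrite distrC.
  - near: t; apply/nbhs_normP; exists rho => // t /=; by rewrite distrC => /ltW.
  - near: t; move/cvgrPdist_le : cxt0 => /(_ _ r0); apply: filterS => t.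
    by rewrite xt0 distrC.
  - near: t; apply: (cxt0 (chart_cod e)); apply: open_nbhs_nbhs.
    by split; [exact: chart_cod_open|rewrite xt0; exact: chart_map_cod].
case/nbhs_normP => d /= d0 Hd; exists (chart_inv e \o x), d; split=> //.
  by rewrite /= xt0 /x0 chart_mapK.
move=> t td; have [th trho txr tcod] : [/\ `|t - t0| < h, `|t - t0| <= rho,
    `|x t - x0| <= r & chart_cod e (x t)] by apply: Hd; rewrite /ball_/= distrC.
have [Jt _] := Hrho t trho; split=> //.
have cg : {for t, continuous (chart_inv e \o x)}.
  by apply: continuous_comp; [exact: cx|exact: chart_inv_continuous].
apply: (chart_coord_has_velocity (chart_at_atlas (1%g : G)) _ cg).
  exact: chart_inv_dom.
rewrite (left_field_chart _ (chart_at_atlas (1%g : G)) (chart_inv_dom tcod)).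
rewrite -/e /= chart_invK//.
have := dx t th; rewrite /F /V clamp_rV_id// /cl clamp_id//.
apply: near_eq_is_derive; near=> s; rewrite /= chart_invK//; near: s.
apply: (cx t th (chart_cod e)); apply: open_nbhs_nbhs.
by split; [exact: chart_cod_open|].
Unshelve. all: by end_near. Qed.

(* Bootstrapping: [b \o c] solves [x' = V x] with [V] smooth, so it is C^(n+1)
   as soon as it is C^n. *)
Lemma left_solution_smooth (xi : 'rV[R]_k) (c : R -> G) :
  (forall t, left_solution (fun=> xi) c t) -> smooth_curve setT c.
Proof.
move=> cs; have cc t : {for t, continuous c} by exact: (cs t).1.
split=> [t _|a b -> Ab]; first exact: cc.
set D : set R^o := [set x | _].
have DE t : D t -> chart_dom b (c t) by case.
have oD : open D.
  by apply: (@open_local_domain _ _ _ _ _ (id_chart R^o) b setT c) => //; exact: openT.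
have dbc t : D t -> is_derive t (1 : R) (b \o c) (\sum_j xi 0 j *: mul_field b j (b (c t))).
  move=> /DE bt; rewrite -left_field_chart//.
  exact: (has_velocity_chart Ab bt (cs t)).
suff : forall n, is_Ck n D (b \o c : R^o -> _) by [].
elim=> [|n IH].
  split; last by [].
  move=> t Dt; apply: continuous_comp; first exact: cc.
  by apply: chart_map_continuous; exact: DE.
split=> [t Dt|v].
  by apply: continuous_comp; [exact: cc|apply: chart_map_continuous; exact: DE].
have dif t : D t -> differentiable (b \o c : R^o -> _) t.
  by move=> /dbc; exact: is_derive_differentiable.
split=> [t Dt|]; first exact/diff_derivable/dif.
(* The source is one-dimensional: the derivative along [v] is [v] times the velocity. *)
apply: (@is_Ck_congr _ _ _ _ _ (fun t : R^o =>
  \sum_j (v * xi 0 j : R^o) *: mul_field b j (b (c t)))) => //.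
  move=> t Dt; rewrite deriveE; last exact: dif.
  rewrite -[v in RHS]mulr1 -[v * 1 in RHS]/(v *: (1 : R^o)) linearZ/= -deriveE;
    last exact: dif.
  rewrite (@derive_val _ _ _ _ _ _ _ (dbc t Dt)) scaler_sumr.
  by apply: eq_bigr => j _; rewrite scalerA.
apply: is_Ck_sum => // j; apply: is_Ck_scale => //; first exact: is_Ck_cst.
have [_ /(_ (0, delta_mx 0 j))[_ fk]] := mul_rep_smooth Ab n.+1.
apply: (@is_Ck_comp _ _ _ (prod_coordinates (rV_coordinates k) (rV_coordinates k)) n k
  (mul_dom b) D _ (fun t : R^o => (b (c t), x0)) _ oD _ _ fk).
- exact: open_mul_dom.
- by move=> t /DE bt; exact: mul_dom_chart.
- case=> i /=; last exact: is_Ck_cst.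
  exact: (is_Ck_coord i oD IH).
Qed.

End LocalSolution.

(** * Maximal extensions and global solutions *)

Section MaximalExtension.
Context {R : realType} {T : Type}.
Variable P : (R -> T) -> R -> Prop.
Hypothesis P_local : forall f g t, (\forall s \near t, f s = g s) -> P f t -> P g t.

Definition solves (K : set R) (h : R -> T) : Prop :=
  [/\ open K, is_interval K & forall t, K t -> P h t].

(** Zorn's lemma for an arbitrary local property [P], because it serves twice: for solutions in the
    group and for integral curves in the manifold. *)
Lemma maximal_extension (J : set R) (f : R -> T) : solves J f ->
  exists K h, [/\ solves K h, J `<=` K, (forall t, J t -> h t = f t) &
    forall K' h', solves K' h' -> K `<=` K' -> (forall t, K t -> h' t = h t) ->
      K' `<=` K].
Proof.
move=> Jf.
pose ext (Kh : set R * (R -> T)) :=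
  [/\ solves Kh.1 Kh.2, J `<=` Kh.1 & forall t, J t -> Kh.2 t = f t].
pose S := {Kh | ext Kh}.
pose dom (a : S) := (sval a).1; pose fn (a : S) := (sval a).2.
pose le (a b : S) := `[< dom a `<=` dom b /\ forall t, dom a t -> fn b t = fn a t >].
have leP a b : le a b -> dom a `<=` dom b /\ forall t, dom a t -> fn b t = fn a t.
  by move/asboolP.
have ext0 : ext (J, f) by split.
(* Only a preorder: total functions that agree on their common domain may still differ off it. *)
have [| | |[[K h] Kext] Kmax] := @ZL_preorder S (exist _ _ ext0) le.
- by move=> a; apply/asboolP; split.
- move=> b a d /leP[ab1 ab2] /leP[bd1 bd2]; apply/asboolP; split.
    exact: subset_trans bd1.
  by move=> t at_; rewrite bd2 ?ab2//; exact: ab1.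
- move=> A tA; have [[a0 Aa0]|noA] := pselect (exists a, A a); last first.
    by exists (exist _ _ ext0) => s As; case: noA; exists s.
  have coh a b t : A a -> A b -> dom a t -> dom b t -> fn a t = fn b t.
    by move=> Aa Ab at_ bt; have [/leP[_ ->]|/leP[_ ->]] := tA a b Aa Ab.
  have [h hP] : {h : R -> T & forall t a, A a -> dom a t -> h t = fn a t}.
    apply: (@choice _ _ (fun t y => forall a, A a -> dom a t -> y = fn a t)) => t.
    have [[a [Aa at_]]|no] := pselect (exists a, A a /\ dom a t).
      by exists (fn a t) => b Ab bt; exact: coh.
    by exists (f t) => a Aa at_; case: no; exists a.
  pose K := [set t | exists2 a, A a & dom a t].
  have Kext : ext (K, h).
    split=> /=.
    + split.
      * rewrite openE => t [a Aa at_].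
        have [[oa _ _] _ _] := svalP a.
        have : \forall s \near t, dom a s by exact: open_nbhs_nbhs.
        by apply: filterS => s as_; exists a.
      * move=> x y [a Aa ax] [b Ab by_] z xzy.
        have [/leP[ab _]|/leP[ba _]] := tA a b Aa Ab.
          by exists b => //; have [[_ ib _] _ _] := svalP b; apply: ib xzy => //; exact: ab.
        by exists a => //; have [[_ ia _] _ _] := svalP a; apply: ia xzy => //; exact: ba.
      * move=> t [a Aa at_]; have [[oa _ Pa] _ _] := svalP a.
        apply: P_local (Pa t at_).
        have : \forall s \near t, dom a s by exact: open_nbhs_nbhs.
        by apply: filterS => s as_; rewrite (hP s a).
    + by move=> t Jt; exists a0 => //; have [_ + _] := svalP a0; apply.
    + move=> t Jt; have [_ Ja ha] := svalP a0.
      by rewrite (hP t a0)//; [exact: ha|exact: Ja].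
  exists (exist _ _ Kext) => a Aa; apply/asboolP; split.
    by move=> t at_; exists a.
  by move=> t at_ /=; exact: hP.
have [Ks JK hf] := Kext; exists K, h; split=> // K' h' K's KK' h'h.
have ext' : ext (K', h').
  split=> //=; first exact: subset_trans KK'.
  by move=> t Jt; rewrite (h'h t (JK t Jt)); exact: hf.
have /Kmax/leP[] // : le (exist _ _ Kext) (exist _ _ ext').
by apply/asboolP; split.
Qed.

End MaximalExtension.

Section GlobalSolution.
Context {R : realType} {k : nat} {G : lieGroupType R k}.

Lemma left_solution_near (w : R -> 'rV[R]_k) (f g : R -> G) t :
  (\forall s \near t, f s = g s) -> left_solution w f t -> left_solution w g t.
Proof.
move=> fg; rewrite /left_solution -(nbhs_singleton fg).
exact: has_velocity_near.
Qed.

Lemma is_interval_ball (a d : R) : is_interval [set t | `|t - a| < d].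
Proof.
move=> x y /=; rewrite !ltr_norml => /andP[x1 x2] /andP[y1 y2] z /andP[xz zy].
by rewrite ltr_norml; apply/andP; split; lra.
Qed.

Lemma open_ball_set (a d : R) : open [set t : R | `|t - a| < d].
Proof.
have -> : [set t : R | `|t - a| < d] = ball a d.
  by apply/seteqP; split=> t; rewrite -ball_normE/= distrC.
exact: ball_open.
Qed.

(** The domain [K] of a maximal solution is closed in the connected set [J]: at a point of its
    closure a local solution, translated to match, would prolong it. *)
Lemma left_solution_global (J : set R) (w : R -> 'rV[R]_k) : open J -> is_interval J ->
  J 0 -> (forall t, J t -> {for t, continuous w}) ->
  exists g : R -> G, g 0 = 1%g /\ forall t, J t -> left_solution w g t.
Proof.
(* Including [J t] in the property confines every extension to [J]. *)
move=> oJ iJ J0 cw; pose P (g : R -> G) t := J t /\ left_solution w g t.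
have Ploc (f g : R -> G) t : (\forall s \near t, f s = g s) -> P f t -> P g t.
  by move=> fg [Jt /(left_solution_near fg)].
have [f [d [d0 f0 fP]]] := @left_solution_local R k G J w 0 oJ J0 cw.
have ballP a e (h : R -> G) : (forall t, `|t - a| < e -> P h t) ->
    solves P [set t | `|t - a| < e] h.
  by move=> hP; split=> //; [exact: open_ball_set|exact: is_interval_ball].
have [K [h [[oK iK KP] dK hf Kmax]]] := maximal_extension Ploc (ballP _ _ _ fP).
have K0 : K 0 by apply: dK; rewrite /= subrr normr0.
exists h; split; first by rewrite hf ?f0//= subrr normr0.
suff -> : J = K by move=> t /KP[].
apply/esym; have cJ : connected J by apply/connected_intervalP.
apply: cJ.
- by exists 0.
- by exists K => //; apply/seteqP; split=> t; [move=> Kt; split=> //; case: (KP t Kt)|case].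
exists (closure K); first exact: closed_closure.
apply/seteqP; split=> t; first by move=> Kt; split; [case: (KP t Kt)|exact: subset_closure].
move=> [Jt clt].
have [u [e [e0 _ uP]]] := @left_solution_local R k G J w t oJ Jt cw.
pose B := [set s : R | `|s - t| < e].
have tB : B t by rewrite /B/= subrr normr0.
have oB : open B by exact: open_ball_set.
have iB : is_interval B by exact: is_interval_ball.
have [s [Ks Bs]] : K `&` B !=set0 by apply: clt; exact: open_nbhs_nbhs.
(* The left factor that makes [q * u] meet [h] at the common time [s]; uniqueness spreads the
   agreement over all of [K] and [B] in common. *)
pose q := (h s * (u s)^-1)%g.
have hq r : K r -> B r -> h r = (q * u r)%g.
  move=> Kr Br; have iKB : is_interval (K `&` B).
    by move=> x y [Kx Bx] [Ky By] z xzy; split; [exact: (iK x y)|exact: (iB x y)].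
  have := @left_solution_unique _ _ _ (K `&` B) w h u s r (openI oK oB) iKB.
  rewrite -/q => -> //.
  - by rewrite -mulgA mulVg mulg1.
  - by move=> v [/KP[]].
  - by move=> v [_ /uP[]].
pose h' r := if `[< K r >] then h r else (q * u r)%g.
have h'K r : K r -> h' r = h r by rewrite /h' => /asboolP ->.
have h'B r : B r -> h' r = (q * u r)%g.
  by move=> Br; rewrite /h'; case: asboolP => // Kr; exact: hq.
apply: (Kmax (K `|` B) h') => //.
- split; first exact: openU.
    move=> x y [Kx|Bx] [Ky|By] z /andP[xz zy].
    + by left; apply: (iK x y) => //; apply/andP.
    + have [zs|/ltW sz] := leP z s.
        by left; apply: (iK x s) => //; apply/andP.
      by right; apply: (iB s y) => //; apply/andP.
    + have [zs|/ltW sz] := leP z s.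
        by right; apply: (iB x s) => //; apply/andP.
      by left; apply: (iK s y) => //; apply/andP.
    + by right; apply: (iB x y) => //; apply/andP.
  move=> r [Kr|Br].
    apply: Ploc (KP r Kr).
    have : \forall v \near r, K v by exact: open_nbhs_nbhs.
    by apply: filterS => v Kv; rewrite h'K.
  have [Jr ur] := uP r Br.
  have qur : P (fun v => (q * u v)%g) r by split; [|exact: left_solution_mulg].
  apply: Ploc qur.
  have : \forall v \near r, B v by exact: open_nbhs_nbhs.
  by apply: filterS => v Bv; rewrite h'B.
- by right.
Qed.

End GlobalSolution.

(** * One-parameter subgroups and the exponential map *)

Section Exponential.
Context {R : realType} {k : nat} {G : lieGroupType R k}.
Implicit Types (xi : 'rV[R]_k) (c : R -> G).

Lemma left_solution_ext (w : R -> 'rV[R]_k) (g h : R -> G) t :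
  (forall t, left_solution w g t) -> (forall t, left_solution w h t) ->
  g 0 = h 0 -> g t = h t.
Proof.
move=> gs hs gh0.
have := @left_solution_unique _ _ _ setT w g h t 0 openT _
  (fun u _ => gs u) (fun u _ => hs u) I I.
rewrite gh0 mulgV => /(_ _) H.
by rewrite -[LHS]mulg1 -(mulVg (h t)) mulgA H ?mul1g.
Qed.

(** Forward, the homomorphism law carries the velocity at 0 to every time. Backward, [c s * c t] and
    [c (s + t)] solve the same equation in [t] with the same value at 0. *)
Lemma one_parameter_subgroupP xi c :
  one_parameter_subgroup xi c <->
  (forall t, left_solution (fun=> xi) c t) /\ c 0 = 1%g.
Proof.
split=> [[sc cD cxi]|[cs c0]].
  have c0 : c 0 = 1%g.
    have := cD 0 0; rewrite addr0 => /(congr1 (fun x => (x * (c 0)^-1)%g)).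
    by rewrite mulgV mulgK.
  split=> // t; have := smooth_curve_has_velocity openT I sc (t := 0); rewrite cxi => c0v.
  have := has_velocity_map (mulg_tangentiable_r (c t) (c 0)) c0v.
  rewrite c0 => tv.
  (* Near [t] the curve is written as [c t * c (s - t)]. *)
  have := @has_velocity_affine _ _ _ (fun s => (c t * c s)%g) (- t) 1 t
    (left_field (c t) xi).
  rewrite mul1r addNr scale1r => /(_ tv).
  have -> : (fun s => (c t * c (- t + 1 * s))%g) = c.
    by apply/funext => s; rewrite -cD mul1r addrA subrr add0r.
  by [].
split.
- exact: left_solution_smooth cs.
- move=> s t; apply/esym.
  apply: (@left_solution_ext (fun=> xi) (fun t => (c s * c t)%g) (fun t => c (s + t))).
  + by move=> u; apply: left_solution_mulg; exact: cs.
  + move=> u; have := @has_velocity_affine _ _ _ c s 1 u (left_field (c (s + u)) xi).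
    rewrite mul1r scale1r => /(_ (cs _)).
    by have -> : (fun v => c (s + 1 * v)) = (fun v => c (s + v))
      by apply/funext => v; rewrite mul1r.
  + by rewrite c0 mulg1 addr0.
- by rewrite (has_velocity_velocity (cs 0)) c0 left_field1.
Qed.

Lemma exists_one_parameter_subgroup xi : exists c, one_parameter_subgroup xi c.
Proof.
have [|c [c0 cs]] := @left_solution_global R k G setT (fun=> xi) openT _ I
  (fun t _ => cvg_cst _).
  by move=> x y _ _ z _.
by exists c; apply/one_parameter_subgroupP; split=> // t; exact: cs.
Qed.

(** The subgroup picked by [xget] for [t *: xi] and the rescaled curve [c (t * s)] solve the same
    equation; they are compared at [s = 1]. *)
Lemma Lie_expE xi c t : one_parameter_subgroup xi c -> Lie_exp (t *: xi) = c t.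
Proof.
move=> /one_parameter_subgroupP[cs c0].
have [c' c'P] := exists_one_parameter_subgroup (t *: xi).
have /one_parameter_subgroupP[ds d0] := xgetPex (fun=> 1%g) (ex_intro _ c' c'P).
rewrite /Lie_exp; set d := xget _ _ in ds d0 *.
have -> : c t = c (0 + t * 1) by rewrite add0r mulr1.
apply: (@left_solution_ext (fun=> t *: xi) d (fun s => c (0 + t * s)) 1 ds);
  last by rewrite d0 mulr0 addr0 c0.
move=> s; have /has_velocity_affine := cs (0 + t * s).
by rewrite /left_solution /left_field /tangent_map linearZ.
Qed.

End Exponential.

Section SmoothCurves.
Context {R : realType} {l m n : nat}.
Context {L : manifoldType R l} {M : manifoldType R m} {N : manifoldType R n}.

Lemma smooth_curve_sub (J K : set R) (g : R -> M) : K `<=` J ->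
  smooth_curve J g -> smooth_curve K g.
Proof.
move=> KJ [cg sg]; split=> [t /KJ|a b Aa Ab i]; first exact: cg.
by apply: is_Ck_sub (sg a b Aa Ab i) => x [ax /KJ Jx bx]; split.
Qed.

(** Checked near each time, where [x], [y] and the image curve each stay in one chart. It provides
    the smooth curve that [tangent_to] demands in an orbit. *)
Lemma smooth_curve_map2 (f : L * M -> N) (J : set R) (x : R -> L) (y : R -> M) :
  open J -> smooth_map (prod_atlas (atlas L) (atlas M)) (atlas N) setT f ->
  smooth_curve J x -> smooth_curve J y -> smooth_curve J (fun t => f (x t, y t)).
Proof.
move=> oJ sf [cx sx] [cy sy].
have cf z : {for z, continuous f} by case: sf => + _; apply.
have cxy t : J t -> {for t, continuous (fun t => f (x t, y t))}.
  move=> Jt; apply: (@continuous_comp _ _ _ (fun t => (x t, y t)) f) (cf _).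
  by apply: pair_continuous; [exact: cx|exact: cy].
split=> [t Jt|a c -> Ac i]; first exact: cxy.
apply: is_Ck_local => t [_ Jt ct].
pose a1 := chart_at (x t); pose a2 := chart_at (y t).
pose V1 := [set s | [/\ chart_cod (id_chart R^o) s, J (chart_inv (id_chart R^o) s)
                      & chart_dom a1 (x (chart_inv (id_chart R^o) s))]].
pose V2 := [set s | [/\ chart_cod (id_chart R^o) s, J (chart_inv (id_chart R^o) s)
                      & chart_dom a2 (y (chart_inv (id_chart R^o) s))]].
pose V3 := [set s | [/\ chart_cod (id_chart R^o) s, J (chart_inv (id_chart R^o) s)
    & chart_dom c (f (x (chart_inv (id_chart R^o) s), y (chart_inv (id_chart R^o) s)))]].
have oV1 : open V1 by exact: (open_local_domain (id_chart R^o) a1 oJ cx).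
have oV2 : open V2 by exact: (open_local_domain (id_chart R^o) a2 oJ cy).
have oV3 : open V3 by exact: (open_local_domain (id_chart R^o) c oJ cxy).
pose V := V1 `&` V2 `&` V3.
have oV : open V by do 2! apply: openI => //.
exists V; split; first by split; [split; split=> //; exact: chart_at_dom|split].
pose U := [set z | [/\ chart_cod (prod_chart a1 a2) z,
                       [set: L * M] (chart_inv (prod_chart a1 a2) z)
                     & chart_dom c (f (chart_inv (prod_chart a1 a2) z))]].
have oU : open U by apply: open_local_domain => //; exact: openT.
have fU : is_Ck i U (c \o f \o chart_inv (prod_chart a1 a2)).
  case: sf => _; apply=> //; exists a1, a2.
  by split=> //; exact: chart_at_atlas.
apply: (@is_Ck_congr _ _ _ _ _ ((c \o f \o chart_inv (prod_chart a1 a2)) \o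
    (fun s : R^o => (a1 (x s), a2 (y s))))) => //.
  by move=> s [[[_ _ s1] [_ _ s2]] _] /=; rewrite !chart_mapK.
apply: (is_Ck_comp (c := prod_coordinates (rV_coordinates l) (rV_coordinates m)) oU oV _ _ fU).
  move=> s [[[_ _ s1] [_ _ s2]] [_ _ s3]]; split=> //=.
    by split; exact: chart_map_cod.
  by rewrite !chart_mapK.
case=> j /=.
  apply: (@is_Ck_coord _ _ _ _ _ (a1 \o x : R^o -> _)) => //.
  by apply: is_Ck_sub (sx (id_chart R^o) a1 erefl (chart_at_atlas _) i) => s [[]].
apply: (@is_Ck_coord _ _ _ _ _ (a2 \o y : R^o -> _)) => //.
by apply: is_Ck_sub (sy (id_chart R^o) a2 erefl (chart_at_atlas _) i) => s [[]].
Qed.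

End SmoothCurves.

(** * Proper actions *)

Section ProperActions.
Context {R : realType} {k n : nat} {G : lieGroupType R k} {M : manifoldType R n}.
Variable act : G -> M -> M.
Hypothesis actP : proper_action act.

Let act1 := act1 actP.
Let actM := actM actP.

(** The fundamental vector field of [xi], defined as the differential of the orbit map so that
    linearity in [xi] is immediate. *)
Definition infinitesimal_action (xi : 'rV[R]_k) (p : M) : 'rV[R]_n :=
  tangent_map (fun h => act h p) (1%g : G) xi.

Lemma act_tangentiable_l g p : tangentiable (fun h => act h p) g.
Proof. exact: (tangentiable_fst (act_smooth actP) g p).1. Qed.

Lemma act_tangentiable_r g p : tangentiable (act g) p.
Proof. exact: (tangentiable_snd (act_smooth actP) g p).1. Qed.

Lemma induced_vector_fieldE (psi : M -> 'rV[R]_k) p :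
  induced_vector_field act psi p = infinitesimal_action (psi p) p.
Proof.
have [c cP] := @exists_one_parameter_subgroup _ _ G (psi p).
have [cs c0] := (one_parameter_subgroupP _ _).1 cP.
rewrite /induced_vector_field.
have -> : (fun t => act (Lie_exp (t *: psi p)) p) = (fun h => act h p) \o c.
  by apply/funext => t /=; rewrite (Lie_expE t cP).
apply: has_velocity_velocity; have := has_velocity_map (act_tangentiable_l (c 0) p) (cs 0).
by rewrite c0 left_field1.
Qed.

(** Differentiate [(g * h) . p = g . (h . p)] in [h] at 1. *)
Lemma tangent_map_act_left_field g xi p :
  tangent_map (fun h => act h p) g (left_field g xi) =
  tangent_map (act g) p (infinitesimal_action xi p).
Proof.
have t1 := mulg_tangentiable_r g 1%g.
have := act_tangentiable_l (g * 1)%g p => /(tangentiable_comp t1)[_ /(_ xi)].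
have t2 := act_tangentiable_l (1%g : G) p.
have := act_tangentiable_r g (act 1%g p) => /(tangentiable_comp t2)[_ /(_ xi)].
rewrite mulg1 act1 /left_field => <- <-.
have -> // : (fun h => act h p) \o (fun x : G => (g * x)%g) = act g \o (fun h => act h p).
by apply/funext => h; exact: actM.
Qed.

(* If [g] is a curve in the orbit with velocity [v] at [p], then so is
   [exp (t xi) . g t], with velocity [v + xi_M p]. *)
Lemma tangent_to_orbitD p v xi :
  tangent_to (act_orbit act p) p v ->
  tangent_to (act_orbit act p) p (v + infinitesimal_action xi p).
Proof.
move=> [J [g [[oJ J0 sg gJ] [g0 gv]]]].
have [c cP] := @exists_one_parameter_subgroup _ _ G xi.
have [cs c0] := (one_parameter_subgroupP _ _).1 cP; have [sc _ _] := cP.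
exists J, (fun t => act (c t) (g t)); split; [split=> //|split].
- apply: (smooth_curve_map2 oJ (act_smooth actP) _ sg).
  exact: smooth_curve_sub sc.
- move=> _ [t Jt <-]; have [h _ <-] : act_orbit act p (g t) by apply: gJ; exists t.
  by exists (c t * h)%g => //; rewrite actM.
- by rewrite c0 act1.
- have gv0 := smooth_curve_has_velocity oJ J0 sg; rewrite gv in gv0.
  rewrite (has_velocity_velocity (has_velocity_map2 (act_smooth actP) (cs 0) gv0)) /=.
  rewrite c0 left_field1 g0 addrC; congr (_ + _).
  have -> : (fun q => act 1%g q) = id by apply/funext => q; exact: act1.
  exact: tangent_map_id.
Qed.

(** By the Leibniz rule the velocity of [g t . gamma t] is the image under [act (g t)] of
    [- psi_M + (X + psi_M)], taken at [gamma t]; equivariance turns what remains into [X] at the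
    moved point. *)
Lemma integral_curve_twist (X : M -> 'rV[R]_n) (psi : M -> 'rV[R]_k) (J : set R)
    (gamma : R -> M) (g : R -> G) :
  (forall g p, X (act g p) = tangent_map (act g) p (X p)) ->
  integral_curve (fun p => X p + infinitesimal_action (psi p) p) J gamma ->
  (forall t, J t -> left_solution (fun t => - psi (gamma t)) g t) ->
  integral_curve X J (fun t => act (g t) (gamma t)).
Proof.
move=> XE [oJ iJ J0 gammaP] gs; split=> // t Jt.
have := has_velocity_map2 (act_smooth actP) (gs t Jt) (gammaP t Jt).
rewrite /= tangent_map_act_left_field -tangent_mapD XE.
by rewrite /infinitesimal_action tangent_mapN addrCA addNr addr0.
Qed.

Lemma maximal_integral_curve_extension (X : M -> 'rV[R]_n) (J : set R) (gamma : R -> M) :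
  integral_curve X J gamma ->
  exists K delta, [/\ maximal_integral_curve X K delta, J `<=` K &
    forall t, J t -> delta t = gamma t].
Proof.
move=> [oJ iJ J0 gammaP].
have loc (f g : R -> M) t : (\forall s \near t, f s = g s) ->
    has_velocity f t (X (f t)) -> has_velocity g t (X (g t)).
  by move=> fg; rewrite -(nbhs_singleton fg); exact: has_velocity_near.
have [K [d [[oK iK dP] JK dE Kmax]]] :=
  @maximal_extension _ _ (fun f t => has_velocity f t (X (f t))) loc J gamma
    (And3 oJ iJ gammaP).
exists K, d; split=> //; split; first by split=> //; exact: JK.
move=> K' d' [oK' iK' _ d'P] KK' d'E; apply: (Kmax K' d') => //.
by move=> t Kt; apply: d'E; exact: mem_set.
Qed.

End ProperActions.

Theorem proposition3p4 (R : realType) (k n : nat) (G : lieGroupType R k)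
    (M : manifoldType R n) (act : G -> M -> M) (X Y : M -> 'rV[R]_n) (m : M) :
  proper_action act ->
  equivariant_vector_field act X ->
  equivariant_vector_field act Y ->
  isomorphic_vector_fields act X Y ->
  stable_relative_equilibrium act X m ->
  stable_relative_equilibrium act Y m.
Proof.
move=> actP [_ XE] _ [psi [[psic _] _] YE] [Xm Xstable].
have {}YE : Y = fun p => X p + infinitesimal_action act (psi p) p.
  by apply/funext => p; rewrite YE (induced_vector_fieldE actP).
split; first by rewrite /relative_equilibrium YE; exact: tangent_to_orbitD.
move=> U mU Uinv; have [V mV VX] := Xstable U mU Uinv.
exists V => // J gamma [gammaY _] Vgamma t Jt.
have [oJ iJ J0 gammaP] := gammaY.
have [s Js|g [g0 gs]] :=
  @left_solution_global R k G J (fun s => - psi (gamma s)) oJ iJ J0.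
  (* Continuity of the right-hand side in time is all that [gamma] offers, and all that
     [left_solution_global] asks. *)
  apply: cvgN; apply: (@continuous_comp _ _ _ gamma psi); last exact: psic.
  exact: (gammaP s Js).1.
rewrite YE in gammaY; have sigmaX := integral_curve_twist actP XE gammaY gs.
(* Stability of [X] applies to the prolonged curve, which starts at [gamma 0] because [g 0 = 1]. *)
have [K [delta [Kmax JK deltaE]]] := maximal_integral_curve_extension sigmaX.
have U_delta : U (delta t).
  by apply: (VX K delta Kmax _ t (JK t Jt)); rewrite deltaE// g0 (act1 actP).
rewrite deltaE// in U_delta.
(* Invariance of [U] undoes the twist at time [t]. *)
have := Uinv ((g t)^-1)%g _ U_delta.
by rewrite -(actM actP) mulVg (act1 actP).
Qed.
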